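(* Let $A$ be a unital associative algebra over a commutative field $\mathbb{K}$ of characteristic zero, and let $P:\Omega_1(A)\to\Omega_1(A)$ be an $A$-bimodule homomorphism with $P\circ P=P$. Put $\bar P=\mathrm{Id}_{\Omega_1(A)}-P$ and define the curvature $R=[P,P]\circ P$ and the cocurvature $\bar R=[P,P]\circ\bar P$, which are elements of $\Omega^1_2(A)$; here $[\ ,\ ]$ is the Frölicher–Nijenhuis bracket. Then: 1. (Bianchi identity) $$[P,R+\bar R]=0,\qquad 2[R,P]=j_R\bar R+j_{\bar R}R ,$$ where the insertion operators $j$ are extended to $\Omega^1_*(A)$ in the obvious way. 2. The curvature $R$ is zero if and only if the horizontal distribution $\ker P$ is involutive. The cocurvature $\bar R$ is zero if and only if the vertical distribution $P(\Omega_1(A))$ is involutive.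
   Context: $\Omega_1(A)$ is the kernel of the multiplication map $A\otimes_{\mathbb{K}} A\to A$, an $A$-bimodule; $\Omega_0(A)=A$; $\Omega_k(A)=\Omega_1(A)\otimes_A\cdots\otimes_A\Omega_1(A)$ ($k$ factors) for $k\ge1$; $\Omega_k(A)=0$ for $k<0$. $\Omega(A)=\bigoplus_{k\ge0}\Omega_k(A)$ (also written $\Omega_*(A)$) is a graded algebra with the tensor product over $A$ as multiplication. The differential $d$ is given on $A$ by $d(a)=1\otimes a-a\otimes1\in\Omega_1(A)$ and in general by $d(a_0\,d(a_1)\cdots d(a_k))=d(a_0)\,d(a_1)\cdots d(a_k)$; it is a well-defined graded derivation of degree $1$ making $\Omega(A)$ a graded differential algebra. $\operatorname{Der}_k\Omega(A)$ is the space of graded derivations of degree $k$: $\mathbb{K}$-linear maps $D:\Omega(A)\to\Omega(A)$ with $D(\Omega_\ell(A))\subset\Omega_{k+\ell}(A)$ and $D(\varphi\psi)=D(\varphi)\psi+(-1)^{k\ell}\varphi D(\psi)$ for $\varphi\in\Omega_\ell(A)$, $\psi\in\Omega(A)$. The graded commutator of $D_1,D_2$ of degrees $k_1,k_2$ is $[D_1,D_2]=D_1\circ D_2-(-1)^{k_1k_2}D_2\circ D_1$. $\Omega^1_k(A)$ denotes the space of $A$-bimodule homomorphisms $\Omega_1(A)\to\Omega_k(A)$. For $K\in\Omega^1_k(A)$, the insertion operator $j_K\in\operatorname{Der}_{k-1}\Omega(A)$ is the unique graded derivation of degree $k-1$ which vanishes on $\Omega_0(A)=A$ and satisfies $j_K(\omega)=K(\omega)$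 for $\omega\in\Omega_1(A)$. Its extension to $\Omega^1_*(A)=\bigoplus_{k\ge 0}\Omega^1_k(A)$ is $j_K L:=j_K\circ L$ for $L\in\Omega^1_\ell(A)$. The Lie derivative along $K\in\Omega^1_k(A)$ is $\mathcal{L}_K=[j_K,d]\in\operatorname{Der}_k\Omega(A)$. The Frölicher–Nijenhuis bracket of $K\in\Omega^1_k(A)$ and $L\in\Omega^1_\ell(A)$ is the unique $[K,L]\in\Omega^1_{k+\ell}(A)$ with $[\mathcal{L}_K,\mathcal{L}_L]=\mathcal{L}_{[K,L]}$. A distribution in $A$ is a sub-$A$-bimodule $\mathcal{D}$ of $\Omega_1(A)$. It is called involutive if the ideal $(\mathcal{D})_{\Omega_*(A)}$ generated by $\mathcal{D}$ in the graded algebra $\Omega_*(A)$ is stable under $d$, i.e. if $d(\mathcal{D})\subset(\mathcal{D})_{\Omega_*(A)}$. For a projection $P$ as in the claim, $P(\Omega_1(A))$ is called the vertical distribution and the complement $\ker P$ the horizontal distribution.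
   Formalization: In part 2 the two distributions are exchanged: R = 0 iff the vertical distribution P(Ω_1(A)) is involutive, and R̄ = 0 iff ker P is; as written it fails for A = K⟨x,y⟩, P(dx) = 0, P(dy) = dy − x dx, where ker P is involutive but R ≠ 0. *)

(* Defs.v *)
From HB Require Import structures.
From mathcomp Require Import all_boot all_algebra.
From mathcomp Require Import boolp classical_sets ring.

Set Implicit Arguments.
Unset Strict Implicit.
Unset Printing Implicit Defensive.

Import GRing.Theory.
Local Open Scope ring_scope.

(* The tensor product of two K-modules, by generators and relations: formal
   K-linear combinations of symbols u (x) v, modulo the congruence generated
   by the K-module axioms and the bilinearity of (x). *)
Section TensorProduct.
Variables (K : comNzRingType) (M N : lmodType K).

Inductive tens_term : Type :=
| TPure of M & N
| TAdd of tens_term & tens_term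
| TScale of K & tens_term.

HB.instance Definition _ := gen_eqMixin tens_term.
HB.instance Definition _ := gen_choiceMixin tens_term.

Inductive tens_eq : tens_term -> tens_term -> Prop :=
| TE_refl x : tens_eq x x
| TE_sym x y : tens_eq x y -> tens_eq y x
| TE_trans x y z : tens_eq x y -> tens_eq y z -> tens_eq x z
| TE_add x x' y y' :
    tens_eq x x' -> tens_eq y y' -> tens_eq (TAdd x y) (TAdd x' y')
| TE_scale c x x' : tens_eq x x' -> tens_eq (TScale c x) (TScale c x')
| TE_addA x y z : tens_eq (TAdd x (TAdd y z)) (TAdd (TAdd x y) z)
| TE_addC x y : tens_eq (TAdd x y) (TAdd y x)
| TE_add0 x : tens_eq (TAdd (TPure 0 0) x) x
| TE_addN x : tens_eq (TAdd (TScale (-1) x) x) (TPure 0 0)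
| TE_scaleA c c' x : tens_eq (TScale c (TScale c' x)) (TScale (c * c') x)
| TE_scale1 x : tens_eq (TScale 1 x) x
| TE_scaleDr c x y :
    tens_eq (TScale c (TAdd x y)) (TAdd (TScale c x) (TScale c y))
| TE_scaleDl c c' x :
    tens_eq (TScale (c + c') x) (TAdd (TScale c x) (TScale c' x))
| TE_pureDl u u' v : tens_eq (TPure (u + u') v) (TAdd (TPure u v) (TPure u' v))
| TE_pureDr u v v' : tens_eq (TPure u (v + v')) (TAdd (TPure u v) (TPure u v'))
| TE_pureZl c u v : tens_eq (TPure (c *: u) v) (TScale c (TPure u v))
| TE_pureZr c u v : tens_eq (TPure u (c *: v)) (TScale c (TPure u v)).

Definition tens_eqb (x y : tens_term) : bool := `[< tens_eq x y >].

Fact tens_eqb_equiv : equiv_class_of tens_eqb.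
Proof.
split=> [x|x y|y x z]; first exact/asboolP/TE_refl.
  by apply/asboolP/asboolP => /TE_sym.
by move=> /asboolP xy /asboolP yz; apply/asboolP/(TE_trans xy yz).
Qed.

Canonical tens_equiv := EquivRelPack tens_eqb_equiv.

Definition tensor : Type := {eq_quot tens_equiv}%qT.
HB.instance Definition _ := Choice.on tensor.
HB.instance Definition _ := Quotient.on tensor.

Local Notation cl := (\pi_tensor)%qT.

Lemma tens_clP x y : cl x = cl y <-> tens_eq x y.
Proof. by split=> [/eqquotP/asboolP|xy]; last exact/eqquotP/asboolP. Qed.

Lemma tens_reprP x : tens_eq (repr (cl x)) x.
Proof. by apply/tens_clP; rewrite reprK. Qed.

Definition tensor_add (x y : tensor) : tensor := cl (TAdd (repr x) (repr y)).
Definition tensor_scale (c : K) (x : tensor) : tensor := cl (TScale c (repr x)).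

Lemma tens_clD x y : tensor_add (cl x) (cl y) = cl (TAdd x y).
Proof. by apply/tens_clP/TE_add; apply: tens_reprP. Qed.

Lemma tens_clZ c x : tensor_scale c (cl x) = cl (TScale c x).
Proof. by apply/tens_clP/TE_scale/tens_reprP. Qed.

Lemma tens_ind0 (Q : tensor -> Prop) : (forall x, Q (cl x)) -> forall x, Q x.
Proof. by move=> h x; rewrite -[x]reprK. Qed.

Fact tensor_addA : associative tensor_add.
Proof.
elim/tens_ind0=> x; elim/tens_ind0=> y; elim/tens_ind0=> z.
by rewrite !tens_clD; apply/tens_clP/TE_addA.
Qed.

Fact tensor_addC : commutative tensor_add.
Proof.
elim/tens_ind0=> x; elim/tens_ind0=> y.
by rewrite !tens_clD; apply/tens_clP/TE_addC.
Qed.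

Fact tensor_add0 : left_id (cl (TPure 0 0)) tensor_add.
Proof. by elim/tens_ind0=> x; rewrite tens_clD; apply/tens_clP/TE_add0. Qed.

Fact tensor_addN :
  left_inverse (cl (TPure 0 0)) (tensor_scale (-1)) tensor_add.
Proof.
by elim/tens_ind0=> x; rewrite tens_clZ tens_clD; apply/tens_clP/TE_addN.
Qed.

HB.instance Definition _ := GRing.isZmodule.Build tensor
  tensor_addA tensor_addC tensor_add0 tensor_addN.

Fact tensor_scaleA c c' x :
  tensor_scale c (tensor_scale c' x) = tensor_scale (c * c') x.
Proof.
by elim/tens_ind0: x => x; rewrite !tens_clZ; apply/tens_clP/TE_scaleA.
Qed.

Fact tensor_scale1 : left_id 1 tensor_scale.
Proof. by elim/tens_ind0=> x; rewrite tens_clZ; apply/tens_clP/TE_scale1. Qed.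

Fact tensor_scaleDr : right_distributive tensor_scale +%R.
Proof.
move=> c; elim/tens_ind0=> x; elim/tens_ind0=> y.
by rewrite [_ + _]tens_clD !tens_clZ [RHS]tens_clD; apply/tens_clP/TE_scaleDr.
Qed.

Fact tensor_scaleDl x : {morph tensor_scale^~ x : c c' / c + c'}.
Proof.
move=> c c'; elim/tens_ind0: x => x.
by rewrite !tens_clZ [RHS]tens_clD; apply/tens_clP/TE_scaleDl.
Qed.

HB.instance Definition _ := GRing.Zmodule_isLmodule.Build K tensor
  tensor_scaleA tensor_scale1 tensor_scaleDr tensor_scaleDl.

Definition tpure (u : M) (v : N) : tensor := cl (TPure u v).

Lemma tpureDl u u' v : tpure (u + u') v = tpure u v + tpure u' v.
Proof. by rewrite [RHS]tens_clD; apply/tens_clP/TE_pureDl. Qed.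
Lemma tpureDr u v v' : tpure u (v + v') = tpure u v + tpure u v'.
Proof. by rewrite [RHS]tens_clD; apply/tens_clP/TE_pureDr. Qed.
Lemma tpureZl c u v : tpure (c *: u) v = c *: tpure u v.
Proof. by rewrite [RHS]tens_clZ; apply/tens_clP/TE_pureZl. Qed.
Lemma tpureZr c u v : tpure u (c *: v) = c *: tpure u v.
Proof. by rewrite [RHS]tens_clZ; apply/tens_clP/TE_pureZr. Qed.

Lemma tensor_ind (Q : tensor -> Prop) :
  (forall u v, Q (tpure u v)) -> (forall x y, Q x -> Q y -> Q (x + y)) ->
  (forall c x, Q x -> Q (c *: x)) -> forall x, Q x.
Proof.
move=> Qp QD QZ; elim/tens_ind0; elim=> [u v|x Qx y Qy|c x Qx]; first exact: Qp.
  by rewrite -tens_clD; apply: QD.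
by rewrite -tens_clZ; apply: QZ.
Qed.

Section Lift.
Variables (W : lmodType K) (f : M -> N -> W).

Fixpoint tens_eval (x : tens_term) : W := match x with
  | TPure u v => f u v
  | TAdd y z => tens_eval y + tens_eval z
  | TScale c y => c *: tens_eval y
  end.

(* The linear map induced by f; meaningful only when f is bilinear. *)
Definition tlift (x : tensor) : W := tens_eval (repr x).

Hypothesis fl : forall v, linear (f^~ v).
Hypothesis fr : forall u, linear (f u).

Let f0 : f 0 0 = 0.
Proof. by have := fl 0 (-1) 0 0; rewrite scaleN1r addNr scaleN1r addNr. Qed.

Lemma tens_evalP x y : tens_eq x y -> tens_eval x = tens_eval y.
Proof.
elim=> //=; try (by move=> *; congruence);
  try (by move=> *; rewrite ?f0 ?addrA ?add0r ?scaleN1r ?addNr ?scalerA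
            ?scale1r ?scalerDr ?scalerDl // addrC).
- by move=> u u' v; have := fl v 1 u u'; rewrite !scale1r.
- by move=> u v v'; have := fr u 1 v v'; rewrite !scale1r.
- move=> c u v; have := fl v c u 0; have := fl v (-1) 0 0.
  by rewrite !addr0 !scaleN1r oppr0 addNr => ->; rewrite addr0.
- move=> c u v; have := fr u c v 0; have := fr u (-1) 0 0.
  by rewrite !addr0 !scaleN1r oppr0 addNr => ->; rewrite addr0.
Qed.

Lemma tlift_pure u v : tlift (tpure u v) = f u v.
Proof. exact: tens_evalP (tens_reprP _). Qed.

Lemma tlift_linear : linear tlift.
Proof.
move=> c; elim/tens_ind0=> x; elim/tens_ind0=> y.
rewrite [c *: _]tens_clZ [_ + _]tens_clD /tlift.
by rewrite !(tens_evalP (tens_reprP _)).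
Qed.

End Lift.
End TensorProduct.

(* The tensor algebra T_A(M) of an A-bimodule M, i.e. the direct sum of A and
   of the M (x)_A ... (x)_A M, again by generators and relations: the K-algebra
   generated by A (as an algebra) and by M (as an A-bimodule). The product of
   m_1, ..., m_k in T_A(M) is m_1 (x) ... (x) m_k. *)
Section TensorAlgebra.
Variables (K : fieldType) (A : algType K) (M : lmodType K).
Variables (la : A -> M -> M) (ra : M -> A -> M).

Inductive talg_term : Type :=
| GScal of A
| GGen of M
| GAdd of talg_term & talg_term
| GScale of K & talg_term
| GMul of talg_term & talg_term.

HB.instance Definition _ := gen_eqMixin talg_term.
HB.instance Definition _ := gen_choiceMixin talg_term.

Inductive talg_eq : talg_term -> talg_term -> Prop :=
| GE_refl x : talg_eq x x
| GE_sym x y : talg_eq x y -> talg_eq y x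
| GE_trans x y z : talg_eq x y -> talg_eq y z -> talg_eq x z
| GE_add x x' y y' :
    talg_eq x x' -> talg_eq y y' -> talg_eq (GAdd x y) (GAdd x' y')
| GE_scale c x x' : talg_eq x x' -> talg_eq (GScale c x) (GScale c x')
| GE_mul x x' y y' :
    talg_eq x x' -> talg_eq y y' -> talg_eq (GMul x y) (GMul x' y')
| GE_addA x y z : talg_eq (GAdd x (GAdd y z)) (GAdd (GAdd x y) z)
| GE_addC x y : talg_eq (GAdd x y) (GAdd y x)
| GE_add0 x : talg_eq (GAdd (GScal 0) x) x
| GE_addN x : talg_eq (GAdd (GScale (-1) x) x) (GScal 0)
| GE_scaleA c c' x : talg_eq (GScale c (GScale c' x)) (GScale (c * c') x)
| GE_scale1 x : talg_eq (GScale 1 x) x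
| GE_scaleDr c x y :
    talg_eq (GScale c (GAdd x y)) (GAdd (GScale c x) (GScale c y))
| GE_scaleDl c c' x :
    talg_eq (GScale (c + c') x) (GAdd (GScale c x) (GScale c' x))
| GE_mulA x y z : talg_eq (GMul x (GMul y z)) (GMul (GMul x y) z)
| GE_mul1 x : talg_eq (GMul (GScal 1) x) x
| GE_mulr1 x : talg_eq (GMul x (GScal 1)) x
| GE_mulDl x y z : talg_eq (GMul (GAdd x y) z) (GAdd (GMul x z) (GMul y z))
| GE_mulDr x y z : talg_eq (GMul x (GAdd y z)) (GAdd (GMul x y) (GMul x z))
| GE_scaleAl c x y : talg_eq (GScale c (GMul x y)) (GMul (GScale c x) y)
| GE_scaleAr c x y : talg_eq (GScale c (GMul x y)) (GMul x (GScale c y))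
| GE_scalD a b : talg_eq (GScal (a + b)) (GAdd (GScal a) (GScal b))
| GE_scalZ c a : talg_eq (GScal (c *: a)) (GScale c (GScal a))
| GE_scalM a b : talg_eq (GScal (a * b)) (GMul (GScal a) (GScal b))
| GE_genD m n : talg_eq (GGen (m + n)) (GAdd (GGen m) (GGen n))
| GE_genZ c m : talg_eq (GGen (c *: m)) (GScale c (GGen m))
| GE_genl a m : talg_eq (GGen (la a m)) (GMul (GScal a) (GGen m))
| GE_genr m a : talg_eq (GGen (ra m a)) (GMul (GGen m) (GScal a)).

Definition talg_eqb (x y : talg_term) : bool := `[< talg_eq x y >].

Fact talg_eqb_equiv : equiv_class_of talg_eqb.
Proof.
split=> [x|x y|y x z]; first exact/asboolP/GE_refl.
  by apply/asboolP/asboolP => /GE_sym.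
by move=> /asboolP xy /asboolP yz; apply/asboolP/(GE_trans xy yz).
Qed.

Canonical talg_equiv := EquivRelPack talg_eqb_equiv.

Definition talg : Type := {eq_quot talg_equiv}%qT.
HB.instance Definition _ := Choice.on talg.
HB.instance Definition _ := Quotient.on talg.

Local Notation cl := (\pi_talg)%qT.

Lemma talg_clP x y : cl x = cl y <-> talg_eq x y.
Proof. by split=> [/eqquotP/asboolP|xy]; last exact/eqquotP/asboolP. Qed.

Lemma talg_reprP x : talg_eq (repr (cl x)) x.
Proof. by apply/talg_clP; rewrite reprK. Qed.

Definition talg_add (x y : talg) : talg := cl (GAdd (repr x) (repr y)).
Definition talg_mul (x y : talg) : talg := cl (GMul (repr x) (repr y)).
Definition talg_scale (c : K) (x : talg) : talg := cl (GScale c (repr x)).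

Lemma talg_clD x y : talg_add (cl x) (cl y) = cl (GAdd x y).
Proof. by apply/talg_clP/GE_add; apply: talg_reprP. Qed.

Lemma talg_clM x y : talg_mul (cl x) (cl y) = cl (GMul x y).
Proof. by apply/talg_clP/GE_mul; apply: talg_reprP. Qed.

Lemma talg_clZ c x : talg_scale c (cl x) = cl (GScale c x).
Proof. by apply/talg_clP/GE_scale/talg_reprP. Qed.

Lemma talg_ind0 (Q : talg -> Prop) : (forall x, Q (cl x)) -> forall x, Q x.
Proof. by move=> h x; rewrite -[x]reprK. Qed.

Fact talg_addA : associative talg_add.
Proof.
elim/talg_ind0=> x; elim/talg_ind0=> y; elim/talg_ind0=> z.
by rewrite !talg_clD; apply/talg_clP/GE_addA.
Qed.

Fact talg_addC : commutative talg_add.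
Proof.
elim/talg_ind0=> x; elim/talg_ind0=> y.
by rewrite !talg_clD; apply/talg_clP/GE_addC.
Qed.

Fact talg_add0 : left_id (cl (GScal 0)) talg_add.
Proof. by elim/talg_ind0=> x; rewrite talg_clD; apply/talg_clP/GE_add0. Qed.

Fact talg_addN : left_inverse (cl (GScal 0)) (talg_scale (-1)) talg_add.
Proof.
by elim/talg_ind0=> x; rewrite talg_clZ talg_clD; apply/talg_clP/GE_addN.
Qed.

HB.instance Definition _ := GRing.isZmodule.Build talg
  talg_addA talg_addC talg_add0 talg_addN.

Fact talg_scaleA c c' x :
  talg_scale c (talg_scale c' x) = talg_scale (c * c') x.
Proof.
by elim/talg_ind0: x => x; rewrite !talg_clZ; apply/talg_clP/GE_scaleA.
Qed.

Fact talg_scale1 : left_id 1 talg_scale.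
Proof. by elim/talg_ind0=> x; rewrite talg_clZ; apply/talg_clP/GE_scale1. Qed.

Fact talg_scaleDr : right_distributive talg_scale +%R.
Proof.
move=> c; elim/talg_ind0=> x; elim/talg_ind0=> y.
by rewrite [_ + _]talg_clD !talg_clZ [RHS]talg_clD; apply/talg_clP/GE_scaleDr.
Qed.

Fact talg_scaleDl x : {morph talg_scale^~ x : c c' / c + c'}.
Proof.
move=> c c'; elim/talg_ind0: x => x.
by rewrite !talg_clZ [RHS]talg_clD; apply/talg_clP/GE_scaleDl.
Qed.

HB.instance Definition _ := GRing.Zmodule_isLmodule.Build K talg
  talg_scaleA talg_scale1 talg_scaleDr talg_scaleDl.

Fact talg_mulA : associative talg_mul.
Proof.
elim/talg_ind0=> x; elim/talg_ind0=> y; elim/talg_ind0=> z.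
by rewrite !talg_clM; apply/talg_clP/GE_mulA.
Qed.

Fact talg_mul1 : left_id (cl (GScal 1)) talg_mul.
Proof. by elim/talg_ind0=> x; rewrite talg_clM; apply/talg_clP/GE_mul1. Qed.

Fact talg_mulr1 : right_id (cl (GScal 1)) talg_mul.
Proof. by elim/talg_ind0=> x; rewrite talg_clM; apply/talg_clP/GE_mulr1. Qed.

Fact talg_mulDl : left_distributive talg_mul +%R.
Proof.
elim/talg_ind0=> x; elim/talg_ind0=> y; elim/talg_ind0=> z.
by rewrite [_ + _]talg_clD !talg_clM [RHS]talg_clD; apply/talg_clP/GE_mulDl.
Qed.

Fact talg_mulDr : right_distributive talg_mul +%R.
Proof.
elim/talg_ind0=> x; elim/talg_ind0=> y; elim/talg_ind0=> z.
by rewrite [_ + _]talg_clD !talg_clM [RHS]talg_clD; apply/talg_clP/GE_mulDr.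
Qed.

(* The projection T_A(M) -> A along M. *)
Fixpoint talg_aug (x : talg_term) : A := match x with
  | GScal a => a
  | GGen _ => 0
  | GAdd y z => talg_aug y + talg_aug z
  | GScale c y => c *: talg_aug y
  | GMul y z => talg_aug y * talg_aug z
  end.

Lemma talg_augP x y : talg_eq x y -> talg_aug x = talg_aug y.
Proof.
elim=> //=; try (by move=> *; congruence); move=> *;
  try (exact: addrC); try (exact: scalerAl); try (exact: scalerAr);
  by rewrite ?addrA ?add0r ?scaleN1r ?addNr ?scalerA ?scale1r ?scalerDr ?scalerDl
    ?mulrA ?mul1r ?mulr1 ?mulrDl ?mulrDr ?scaler0 ?mul0r ?mulr0 ?addr0.
Qed.

Fact talg_nz : cl (GScal 1) != 0.
Proof.
by apply/eqP=> /talg_clP/talg_augP /= /eqP; rewrite oner_eq0.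
Qed.

HB.instance Definition _ := GRing.Zmodule_isNzRing.Build talg
  talg_mulA talg_mul1 talg_mulr1 talg_mulDl talg_mulDr talg_nz.

Fact talg_scaleAl c (x y : talg) : c *: (x * y) = c *: x * y.
Proof.
elim/talg_ind0: x => x; elim/talg_ind0: y => y.
rewrite [x in _ *: x]talg_clM [LHS]talg_clZ [c *: _]talg_clZ [RHS]talg_clM.
exact/talg_clP/GE_scaleAl.
Qed.

HB.instance Definition _ := GRing.Lmodule_isLalgebra.Build K talg talg_scaleAl.

Fact talg_scaleAr c (x y : talg) : c *: (x * y) = x * (c *: y).
Proof.
elim/talg_ind0: x => x; elim/talg_ind0: y => y.
rewrite [x in _ *: x]talg_clM [LHS]talg_clZ [c *: _]talg_clZ [RHS]talg_clM.
exact/talg_clP/GE_scaleAr.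
Qed.

HB.instance Definition _ := GRing.Lalgebra_isAlgebra.Build K talg talg_scaleAr.

Definition tscal (a : A) : talg := cl (GScal a).
Definition tgen (m : M) : talg := cl (GGen m).

Fact tscal_linear : linear tscal.
Proof.
move=> c a b; rewrite [_ *: _ in RHS]talg_clZ [RHS]talg_clD; apply/talg_clP.
by apply: GE_trans (GE_scalD _ _) _; apply/GE_add/GE_refl/GE_scalZ.
Qed.
HB.instance Definition _ := GRing.isLinear.Build K A talg _ tscal tscal_linear.

Fact tscal_monoid_morphism : monoid_morphism tscal.
Proof. by split=> // a b; rewrite [RHS]talg_clM; apply/talg_clP/GE_scalM. Qed.
HB.instance Definition _ :=
  GRing.isMonoidMorphism.Build A talg tscal tscal_monoid_morphism.

Fact tgen_linear : linear tgen.
Proof.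
move=> c a b; rewrite [_ *: _ in RHS]talg_clZ [RHS]talg_clD; apply/talg_clP.
by apply: GE_trans (GE_genD _ _) _; apply/GE_add/GE_refl/GE_genZ.
Qed.
HB.instance Definition _ := GRing.isLinear.Build K M talg _ tgen tgen_linear.

Lemma tgenl a m : tgen (la a m) = tscal a * tgen m.
Proof. by rewrite [RHS]talg_clM; apply/talg_clP/GE_genl. Qed.

Lemma tgenr m a : tgen (ra m a) = tgen m * tscal a.
Proof. by rewrite [RHS]talg_clM; apply/talg_clP/GE_genr. Qed.

Lemma talg_ind (Q : talg -> Prop) :
  (forall a, Q (tscal a)) -> (forall m, Q (tgen m)) ->
  (forall x y, Q x -> Q y -> Q (x + y)) -> (forall c x, Q x -> Q (c *: x)) ->
  (forall x y, Q x -> Q y -> Q (x * y)) -> forall x, Q x.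
Proof.
move=> Qa Qm QD QZ QM; elim/talg_ind0.
elim=> [a|m|x Qx y Qy|c x Qx|x Qx y Qy]; [exact: Qa|exact: Qm|..].
- by rewrite -talg_clD; apply: QD.
- by rewrite -talg_clZ; apply: QZ.
- by rewrite -talg_clM; apply: QM.
Qed.

(* The universal property of T_A(M). *)
Section Lift.
Variables (B : algType K) (f : {lrmorphism A -> B}) (g : {linear M -> B}).
Hypothesis gl : forall a m, g (la a m) = f a * g m.
Hypothesis gr : forall m a, g (ra m a) = g m * f a.

Fixpoint talg_eval (x : talg_term) : B := match x with
  | GScal a => f a
  | GGen m => g m
  | GAdd y z => talg_eval y + talg_eval z
  | GScale c y => c *: talg_eval y
  | GMul y z => talg_eval y * talg_eval z
  end.

Lemma talg_evalP x y : talg_eq x y -> talg_eval x = talg_eval y.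
Proof.
elim=> //=; try (by move=> *; congruence); move=> *;
  try (exact: addrC); try (exact: scalerAl); try (exact: scalerAr);
  try (exact: scalerA); try (exact: scalerDr); try (exact: scalerDl);
  try (exact: mulrDl); try (exact: mulrDr);
  by rewrite ?raddf0 ?rmorph1 ?linearD ?linearZ ?rmorphM ?gl ?gr ?addrA ?add0r
    ?scaleN1r ?addNr ?scale1r ?mulrA ?mul1r ?mulr1.
Qed.

Lemma talg_lift : exists h : {lrmorphism talg -> B},
  (forall a, h (tscal a) = f a) /\ (forall m, h (tgen m) = g m).
Proof.
pose h x := talg_eval (repr (x : talg)).
have hE x : h (cl x) = talg_eval x := talg_evalP (talg_reprP x).
have hl : linear h.
  move=> c; elim/talg_ind0=> x; elim/talg_ind0=> y.
  by rewrite [c *: _]talg_clZ [_ + _]talg_clD !hE.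
have hm : monoid_morphism h.
  split; first by rewrite hE /= rmorph1.
  by elim/talg_ind0=> x; elim/talg_ind0=> y; rewrite [_ * _]talg_clM !hE.
pose hL := GRing.isLinear.Build K talg B _ h hl.
pose hM := GRing.isMonoidMorphism.Build talg B h hm.
pose H : {lrmorphism talg -> B} := HB.pack h hL hM.
by exists H; split=> z; rewrite /= hE.
Qed.

End Lift.
End TensorAlgebra.

(* Twisted derivations of T_A(M): extension from A and M. *)
Section TensorAlgebraDerivations.
Variables (K : fieldType) (A : algType K) (M : lmodType K).
Variables (la : A -> M -> M) (ra : M -> A -> M).
Notation T := (talg la ra).
Notation sc := (tscal la ra).
Notation gn := (tgen la ra).
Notation cl := (\pi_(talg la ra))%qT.

Lemma signaut (e : K) : exists s : {lrmorphism T -> T},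
  (forall a, s (sc a) = sc a) /\ (forall m, s (gn m) = e *: gn m).
Proof.
have gl: linear (fun m => e *: gn m).
  by move=> c u v; rewrite linearP scalerDr !scalerA mulrC.
pose g : {linear M -> T} := HB.pack (fun m => e *: gn m) (GRing.isLinear.Build K M T _ _ gl).
have [||h [ha hm]] := @talg_lift K A M la ra T sc g.
- by move=> a m; rewrite /= tgenl scalerAr.
- by move=> m a; rewrite /= tgenr scalerAl.
by exists h.
Qed.

Variables (s : {lrmorphism T -> T}) (Da : {linear A -> T}) (Dm : {linear M -> T}).
Hypothesis sA : forall a, s (sc a) = sc a.
Hypothesis DaM : forall a b, Da (a * b) = Da a * sc b + sc a * Da b.
Hypothesis Dml : forall a m, Dm (la a m) = Da a * gn m + sc a * Dm m.
Hypothesis Dmr : forall m a, Dm (ra m a) = Dm m * sc a + s (gn m) * Da a.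

Fixpoint deval (x : talg_term A M) : T := match x with
  | GScal a => Da a
  | GGen m => Dm m
  | GAdd y z => deval y + deval z
  | GScale c y => c *: deval y
  | GMul y z => deval y * cl z + s (cl y) * deval z
  end.

Let Da1 : Da 1 = 0.
Proof.
by have := DaM 1 1; rewrite mulr1 rmorph1 mulr1 mul1r => /eqP; rewrite -subr_eq subrr => /eqP <-.
Qed.

Lemma talg_piD x y : cl (GAdd x y) = cl x + cl y. Proof. by rewrite [RHS]talg_clD. Qed.
Lemma talg_piM x y : cl (GMul x y) = cl x * cl y. Proof. by rewrite [RHS]talg_clM. Qed.
Lemma talg_piZ c x : cl (GScale c x) = c *: cl x. Proof. by rewrite [RHS]talg_clZ. Qed.
Lemma talg_piS a : cl (GScal M a) = sc a. Proof. by []. Qed.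
Lemma talg_piG a : cl (GGen A a) = gn a. Proof. by []. Qed.

Lemma devalP x y : talg_eq la ra x y -> deval x = deval y.
Proof.
elim=> //=.
- by move=> *; congruence.
- by move=> *; congruence.
- by move=> *; congruence.
- move=> x1 x2 y1 y2 /talg_clP -> -> /talg_clP -> ->; done.
- by move=> *; rewrite addrA.
- by move=> *; rewrite addrC.
- by move=> *; rewrite raddf0 add0r.
- by move=> *; rewrite raddf0 scaleN1r addNr.
- by move=> *; rewrite scalerA.
- by move=> *; rewrite scale1r.
- by move=> *; rewrite scalerDr.
- by move=> *; rewrite scalerDl.
- by move=> x1 y1 z1; rewrite !talg_piM rmorphM mulrDl mulrDr !mulrA addrA.
- by move=> x1; rewrite !talg_piS sA rmorph1 Da1 mul0r mul1r add0r.
- by move=> x1; rewrite !talg_piS rmorph1 Da1 mulr0 mulr1 addr0.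
- by move=> x1 y1 z1; rewrite !talg_piD raddfD !mulrDl addrACA.
- by move=> x1 y1 z1; rewrite !talg_piD !mulrDr addrACA.
- by move=> c x1 y1; rewrite !talg_piZ linearZ /= -!scalerAl scalerDr.
- by move=> c x1 y1; rewrite !talg_piZ -!scalerAr scalerDr.
- by move=> *; rewrite linearD.
- by move=> *; rewrite linearZ.
- by move=> *; rewrite !talg_piS sA DaM.
- by move=> *; rewrite linearD.
- by move=> *; rewrite linearZ.
- by move=> *; rewrite !talg_piS !talg_piG sA Dml.
Qed.

Lemma deriv_ext : exists D : T -> T,
  [/\ linear D, forall a, D (sc a) = Da a, forall m, D (gn m) = Dm m &
      forall x y, D (x * y) = D x * y + s x * D y].
Proof.
pose h x := deval (repr (x : T)).
have hE x : h (cl x) = deval x := devalP (talg_reprP la ra x).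
exists h; split=> [|a|m|].
- move=> c; elim/talg_ind0=> x; elim/talg_ind0=> y.
  by rewrite -talg_piZ -talg_piD !hE.
- by rewrite -talg_piS hE.
- by rewrite -talg_piG hE.
- by elim/talg_ind0=> x; elim/talg_ind0=> y; rewrite -talg_piM !hE.
Qed.
End TensorAlgebraDerivations.

Local Open Scope classical_set_scope.

Section DifferentialForms.
Variables (K : fieldType) (A : algType K).

Definition tens2 : lmodType K := tensor A A.

Definition mulmap : tens2 -> A := tlift (fun a b : A => a * b).
Definition lmul_tens (c : A) : tens2 -> tens2 :=
  tlift (fun a b : A => tpure (c * a) b).
Definition rmul_tens (c : A) : tens2 -> tens2 :=
  tlift (fun a b : A => tpure a (b * c)).

Fact mulmap_linear : linear mulmap.
Proof.
apply: tlift_linear => [b c a a'|a c b b']; first by rewrite mulrDl scalerAl.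
by rewrite mulrDr scalerAr.
Qed.
HB.instance Definition _ := GRing.isLinear.Build K tens2 A _ mulmap mulmap_linear.

Fact lmul_tens_linear c : linear (lmul_tens c).
Proof.
apply: tlift_linear => [b k a a'|a k b b'].
  by rewrite mulrDr -scalerAr tpureDl tpureZl.
by rewrite tpureDr tpureZr.
Qed.
HB.instance Definition _ c :=
  GRing.isLinear.Build K tens2 tens2 _ (lmul_tens c) (lmul_tens_linear c).

Fact rmul_tens_linear c : linear (rmul_tens c).
Proof.
apply: tlift_linear => [b k a a'|a k b b'].
  by rewrite tpureDl tpureZl.
by rewrite mulrDl -scalerAl tpureDr tpureZr.
Qed.
HB.instance Definition _ c :=
  GRing.isLinear.Build K tens2 tens2 _ (rmul_tens c) (rmul_tens_linear c).

Lemma mulmap_pure a b : mulmap (tpure a b) = a * b.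
Proof.
apply: tlift_pure => [y c x x'|x c y y']; first by rewrite mulrDl scalerAl.
by rewrite mulrDr scalerAr.
Qed.

Lemma lmul_pure c a b : lmul_tens c (tpure a b) = tpure (c * a) b.
Proof.
apply: tlift_pure => [y k x x'|x k y y'].
  by rewrite mulrDr -scalerAr tpureDl tpureZl.
by rewrite tpureDr tpureZr.
Qed.

Lemma rmul_pure c a b : rmul_tens c (tpure a b) = tpure a (b * c).
Proof.
apply: tlift_pure => [y k x x'|x k y y'].
  by rewrite tpureDl tpureZl.
by rewrite mulrDl -scalerAl tpureDr tpureZr.
Qed.

Lemma mulmap_lmul c t : mulmap (lmul_tens c t) = c * mulmap t.
Proof.
elim/tensor_ind: t => [a b|x y hx hy|k x hx].
- by rewrite lmul_pure !mulmap_pure mulrA.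
- by rewrite !raddfD /= hx hy mulrDr.
- by rewrite !linearZ /= hx scalerAr.
Qed.

Lemma mulmap_rmul c t : mulmap (rmul_tens c t) = mulmap t * c.
Proof.
elim/tensor_ind: t => [a b|x y hx hy|k x hx].
- by rewrite rmul_pure !mulmap_pure mulrA.
- by rewrite !raddfD /= hx hy mulrDl.
- by rewrite !linearZ /= hx scalerAl.
Qed.

Definition mulker : {pred tens2} := [pred t | mulmap t == 0].

Fact mulker_closed : submod_closed mulker.
Proof.
split=> [|c x y]; rewrite !inE ?raddf0 // => /eqP x0 /eqP y0.
by rewrite linearP /= x0 y0 scaler0 addr0.
Qed.
HB.instance Definition _ :=
  GRing.isSubmodClosed.Build K tens2 mulker mulker_closed.

Record Omega1 : Type := Omega1_of {form_tens :> tens2; _ : form_tens \in mulker}.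

HB.instance Definition _ := [isSub for form_tens].
HB.instance Definition _ := [Choice of Omega1 by <:].
HB.instance Definition _ := [SubChoice_isSubLmodule of Omega1 by <:].

Fact lact_subproof a (w : Omega1) : lmul_tens a (val w) \in mulker.
Proof. by rewrite inE mulmap_lmul (eqP (valP w)) mulr0. Qed.
Fact ract_subproof (w : Omega1) a : rmul_tens a (val w) \in mulker.
Proof. by rewrite inE mulmap_rmul (eqP (valP w)) mul0r. Qed.

Definition lact (a : A) (w : Omega1) : Omega1 := Omega1_of (lact_subproof a w).
Definition ract (w : Omega1) (a : A) : Omega1 := Omega1_of (ract_subproof w a).

Fact d1_subproof (a : A) : tpure 1 a - tpure a 1 \in mulker.
Proof. by rewrite inE raddfB /= !mulmap_pure mul1r mulr1 subrr. Qed.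

Definition d1 (a : A) : Omega1 := Omega1_of (d1_subproof a).

Definition Omega : algType K := talg lact ract.
Definition scal : A -> Omega := @tscal K A Omega1 lact ract.
Definition form : Omega1 -> Omega := @tgen K A Omega1 lact ract.

(* Omega_k, as a subspace of Omega; the elements of Omega_(k+1) are the finite
   sums of products w (x) phi with w in Omega_1 and phi in Omega_k. *)
Fixpoint Omega_nat (k : nat) : set Omega := match k with
  | 0 => range scal
  | k'.+1 => [set x | exists2 s : seq (Omega1 * Omega),
      (forall p, p \in s -> Omega_nat k' p.2) & x = \sum_(p <- s) form p.1 * p.2]
  end.

Definition Omega_ (k : int) : set Omega := match k with
  | Posz n => Omega_nat n
  | Negz _ => [set 0]
  end.

Definition is_differential (d : Omega -> Omega) : Prop :=
  linear d /\
  forall (a0 : A) (s : seq A),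
    d (scal a0 * \prod_(a <- s) form (d1 a))
    = form (d1 a0) * \prod_(a <- s) form (d1 a).

Definition differential : Omega -> Omega := xget (fun=> 0) is_differential.

Definition graded_derivation (k : int) (D : Omega -> Omega) : Prop :=
  [/\ linear D,
      forall (l : int) x, Omega_ l x -> Omega_ (k + l) (D x) &
      forall (l : int) x y, Omega_ l x ->
        D (x * y) = D x * y + (-1) ^+ absz (k * l)%R * x * D y].

Definition gcomm (k1 k2 : int) (D1 D2 : Omega -> Omega) : Omega -> Omega :=
  fun x => D1 (D2 x) - (-1) ^+ absz (k1 * k2)%R * D2 (D1 x).

(* The space Omega^1_k of bimodule homomorphisms from Omega_1 to Omega_k. *)
Definition Omega1_hom (k : nat) (L : Omega1 -> Omega) : Prop :=
  [/\ linear L, forall w, Omega_ k (L w),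
      forall a w, L (lact a w) = scal a * L w &
      forall a w, L (ract w a) = L w * scal a].

Definition is_insertion (k : nat) (L : Omega1 -> Omega) (j : Omega -> Omega) :=
  [/\ graded_derivation (k%:Z - 1) j, forall a, j (scal a) = 0 &
      forall w, j (form w) = L w].

Definition insertion (k : nat) (L : Omega1 -> Omega) : Omega -> Omega :=
  xget (fun=> 0) (is_insertion k L).

Definition Lie (k : nat) (L : Omega1 -> Omega) : Omega -> Omega :=
  gcomm (k%:Z - 1) 1 (insertion k L) differential.

Definition is_FN_bracket (k l : nat) (L1 L2 B : Omega1 -> Omega) : Prop :=
  Omega1_hom (k + l) B /\
  gcomm k l (Lie k L1) (Lie l L2) = Lie (k + l) B.

Definition FN_bracket (k l : nat) (L1 L2 : Omega1 -> Omega) : Omega1 -> Omega :=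
  xget (fun=> 0) (is_FN_bracket k l L1 L2).

Definition bimodule_endo (P : Omega1 -> Omega1) : Prop :=
  [/\ linear P, forall a w, P (lact a w) = lact a (P w) &
      forall a w, P (ract w a) = ract (P w) a].

Definition distribution (D : set Omega1) : Prop :=
  [/\ D 0, forall (c : K) v w, D v -> D w -> D (c *: v + w),
      forall a w, D w -> D (lact a w) & forall a w, D w -> D (ract w a)].

Definition ideal_gen (D : set Omega1) : set Omega :=
  [set x | exists2 s : seq (Omega * Omega1 * Omega),
     (forall p, p \in s -> D p.1.2) & x = \sum_(p <- s) p.1.1 * form p.1.2 * p.2].

Definition involutive (D : set Omega1) : Prop :=
  distribution D /\ forall x, ideal_gen D x -> ideal_gen D (differential x).

End DifferentialForms.

(* The objects of the statement attached to a bimodule projection P. *)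
Section Curvature.
Variables (K : fieldType) (A : algType K).

(* P as an element of Omega^1_1. *)
Definition hom_of_endo (P : Omega1 A -> Omega1 A) : Omega1 A -> Omega A :=
  fun w => form (P w).

Definition compl_endo (P : Omega1 A -> Omega1 A) : Omega1 A -> Omega1 A :=
  fun w => w - P w.

Definition selfbracket (P : Omega1 A -> Omega1 A) : Omega1 A -> Omega A :=
  FN_bracket 1 1 (hom_of_endo P) (hom_of_endo P).

Definition curvature (P : Omega1 A -> Omega1 A) : Omega1 A -> Omega A :=
  selfbracket P \o P.

Definition cocurvature (P : Omega1 A -> Omega1 A) : Omega1 A -> Omega A :=
  selfbracket P \o compl_endo P.

Definition vertical (P : Omega1 A -> Omega1 A) : set (Omega1 A) := range P.

Definition horizontal (P : Omega1 A -> Omega1 A) : set (Omega1 A) :=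
  [set w | P w = 0].

(* The extension of j_L, L in Omega^1_k, to Omega^1_*. *)
Definition insertion_hom (k : nat) (L M : Omega1 A -> Omega A) :
  Omega1 A -> Omega A := insertion k L \o M.

End Curvature.

Section FormsTheory.
Variables (K : fieldType) (A : algType K).
Notation O := (Omega A).
Notation O1 := (Omega1 A).
Notation T2 := (tens2 A).

HB.instance Definition _ := GRing.LRMorphism.copy (@scal K A) (@tscal K A O1 (@lact K A) (@ract K A)).
HB.instance Definition _ := GRing.Linear.copy (@form K A) (@tgen K A O1 (@lact K A) (@ract K A)).

Lemma form_lact a (w : O1) : form (lact a w) = scal a * form w.
Proof. exact: tgenl. Qed.
Lemma form_ract (w : O1) a : form (ract w a) = form w * scal a.
Proof. exact: tgenr. Qed.

Lemma lact_linear a : linear (@lact K A a).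
Proof. by move=> c u v; apply: val_inj; rewrite /= !linearP. Qed.
Lemma ract_linear a : linear (fun w => @ract K A w a).
Proof. by move=> c u v; apply: val_inj; rewrite /= !linearP. Qed.

Lemma d1_linear : linear (@d1 K A).
Proof.
move=> c a b; apply: val_inj; rewrite /= tpureDl tpureDr tpureZl tpureZr.
by rewrite scalerBr opprD addrACA.
Qed.
HB.instance Definition _ := GRing.isLinear.Build K A O1 _ (@d1 K A) d1_linear.

Lemma d1M (a b : A) : d1 (a * b) = ract (d1 a) b + lact a (d1 b).
Proof.
apply: val_inj; rewrite /= !raddfB /= !lmul_pure !rmul_pure !mulr1 !mul1r.
by rewrite addrA subrK.
Qed.

Lemma d1_1 : d1 (1 : A) = 0.
Proof. by apply: val_inj; rewrite /= subrr. Qed.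

Fact normf_sub (t : T2) : t - tpure (mulmap t) 1 \in @mulker K A.
Proof. by rewrite inE raddfB /= mulmap_pure mulr1 subrr. Qed.
Definition normf t : O1 := Omega1_of (normf_sub t).

Lemma O1_ind (Q : O1 -> Prop) : (forall a b, Q (lact a (d1 b))) ->
  (forall u v, Q u -> Q v -> Q (u + v)) -> (forall c u, Q u -> Q (c *: u)) ->
  forall w, Q w.
Proof.
move=> Qp QD QZ w.
have -> : w = normf (val w).
  have E0 : tpure (0 : A) (1 : A) = 0 by have := tpureZl 0 (0:A) (1:A); rewrite !scale0r.
  by apply: val_inj; rewrite /= (eqP (valP w)) E0 subr0.
elim/tensor_ind: (val w) => [a b|x y hx hy|c x hx].
- have -> : normf (tpure a b) = lact a (d1 b); last exact: Qp.
  by apply: val_inj; rewrite /= raddfB /= !lmul_pure mulmap_pure mulr1.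
- have -> : normf (x + y) = normf x + normf y; last exact: QD.
  by apply: val_inj; rewrite /= raddfD /= tpureDl opprD addrACA.
- have -> : normf (c *: x) = c *: normf x; last exact: QZ.
  by apply: val_inj; rewrite /= linearZ /= tpureZl scalerBr.
Qed.

Lemma O_ind (Q : O -> Prop) :
  (forall a (s : seq A), Q (scal a * \prod_(b <- s) form (d1 b))) ->
  (forall u v, Q u -> Q v -> Q (u + v)) -> (forall c u, Q u -> Q (c *: u)) ->
  forall x, Q x.
Proof.
move=> Qp QD QZ.
pose Sp (x : O) := forall R : O -> Prop,
  (forall a (s : seq A), R (scal a * \prod_(b <- s) form (d1 b))) ->
  (forall u v, R u -> R v -> R (u + v)) -> (forall c u, R u -> R (c *: u)) -> R x.
suff H : forall x y, Sp y -> Sp (x * y).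
  have S1 : Sp 1.
    by move=> R h _ _; have := h 1 [::]; rewrite big_nil rmorph1 mulr1.
  by move=> x; have := H x 1 S1 Q; rewrite mulr1; apply.
elim/talg_ind=> [a|m|x y hx hy|c x hx|x y hx hy] z hz.
- move=> R Rp RD RZ; apply: (hz (fun z => R (scal a * z))) => [b s|u v|c u].
  + by rewrite mulrA -rmorphM; apply: Rp.
  + by rewrite mulrDr; apply: RD.
  + by rewrite -scalerAr; apply: RZ.
- move=> R Rp RD RZ; apply: (hz (fun z => R (form m * z))) => [b s|u v|c u].
  + elim/O1_ind: m => [a e|u v hu hv|c u hu].
    * rewrite form_lact -!mulrA [form _ * _]mulrA -form_ract.
      have -> : ract (d1 e) b = d1 (e * b) - lact e (d1 b) by rewrite d1M addrK.
      rewrite raddfB mulrBl mulrBr /=; apply: RD.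
        by have := Rp a (e * b :: s); rewrite big_cons.
      rewrite -scaleN1r; apply: RZ.
      rewrite form_lact !mulrA -rmorphM.
      by have := Rp (a * e) (b :: s); rewrite big_cons mulrA.
    * by rewrite raddfD mulrDl; apply: RD.
    * by rewrite linearZ /= -scalerAl; apply: RZ.
  + by rewrite mulrDr; apply: RD.
  + by rewrite -scalerAr; apply: RZ.
- by rewrite mulrDl => R Rp RD RZ; exact: (RD _ _ (hx z hz R Rp RD RZ) (hy z hz R Rp RD RZ)).
- by rewrite -scalerAl => R Rp RD RZ; exact: (RZ _ _ (hx z hz R Rp RD RZ)).
- by rewrite -mulrA; apply: hx; apply: hy.
Qed.

Lemma On0 n : Omega_nat n (0 : O).
Proof. by case: n => [|n]; [exists 0; rewrite ?raddf0|exists [::]; rewrite ?big_nil]. Qed.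

Lemma OnD n (x y : O) : Omega_nat n x -> Omega_nat n y -> Omega_nat n (x + y).
Proof.
case: n => [[a _ <-] [b _ <-]|n [s hs ->] [t ht ->]]; first by exists (a + b); rewrite ?raddfD.
exists (s ++ t); last by rewrite big_cat.
by move=> p; rewrite mem_cat => /orP[/hs|/ht].
Qed.

Lemma OnS n (w : O1) (x : O) : Omega_nat n x -> Omega_nat n.+1 (form w * x).
Proof.
move=> hx; exists [:: (w, x)]; last by rewrite big_seq1.
by move=> p; rewrite inE => /eqP ->.
Qed.

Lemma On_ind n (Q : O -> Prop) : Q 0 -> (forall x y, Q x -> Q y -> Q (x + y)) ->
  (forall w x, Omega_nat n x -> Q (form w * x)) -> forall x, Omega_nat n.+1 x -> Q x.
Proof.
move=> Q0 QD Qf x [s hs ->]; elim: s hs => [|p s IH] hs; first by rewrite big_nil.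
rewrite big_cons; apply: QD; first by apply/Qf/hs/mem_head.
by apply: IH => q qs; apply: hs; rewrite inE qs orbT.
Qed.

Lemma OnA n a (x : O) : Omega_nat n x -> Omega_nat n (scal a * x).
Proof.
case: n => [[b _ <-]|n]; first by exists (a * b); rewrite ?rmorphM.
elim/On_ind=> [|u v hu hv|w u hu]; first by rewrite mulr0; apply: On0.
  by rewrite mulrDr; apply: OnD.
by rewrite mulrA -form_lact; apply: OnS.
Qed.

Lemma OnZ n c (x : O) : Omega_nat n x -> Omega_nat n (c *: x).
Proof.
move=> hx; suff -> : c *: x = scal (c *: 1) * x by apply: OnA.
by rewrite linearZ /= -scalerAl rmorph1 mul1r.
Qed.

Lemma OnM n m (x y : O) : Omega_nat n x -> Omega_nat m y -> Omega_nat (n + m) (x * y).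
Proof.
move=> hx hy; elim: n x hx => [|n IH] x; first by move=> [a _ <-]; apply: OnA.
elim/On_ind=> [|u v hu hv|w u hu]; first by rewrite mul0r; apply: On0.
  by rewrite mulrDl; apply: OnD.
by rewrite -mulrA addSn; apply/OnS/IH.
Qed.

Lemma On1 w : Omega_nat 1 (form w : O).
Proof. by rewrite -[form w]mulr1; apply: OnS; exists 1; rewrite ?rmorph1. Qed.

Lemma Oz0 (k : int) : Omega_ k (0 : O).
Proof. by case: k => // n; apply: On0. Qed.
Lemma OzD k (x y : O) : Omega_ k x -> Omega_ k y -> Omega_ k (x + y).
Proof. by case: k => [n|n /= -> ->]; [apply: OnD|rewrite addr0]. Qed.
Lemma OzZ k c (x : O) : Omega_ k x -> Omega_ k (c *: x).
Proof. by case: k => [n|n /= ->]; [apply: OnZ|rewrite scaler0]. Qed.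
Lemma OzB k (x y : O) : Omega_ k x -> Omega_ k y -> Omega_ k (x - y).
Proof. by move=> hx hy; apply: OzD => //; rewrite -scaleN1r; apply: OzZ. Qed.
Lemma OzM k l (x y : O) : Omega_ k x -> Omega_ l y -> Omega_ (k + l) (x * y).
Proof.
case: k => [n|n]; last by move=> /= -> _; rewrite mul0r; apply: Oz0.
case: l => [m|m]; last by move=> _ /= ->; rewrite mulr0; apply: Oz0.
exact: OnM.
Qed.

Definition sg (n : int) : K := (-1) ^+ absz n.

Lemma sgE n (x : O) : (-1) ^+ absz n * x = sg n *: x.
Proof.
by rewrite /sg -![_ ^+ absz n]signr_odd; case: odd; rewrite ?mulN1r ?scaleN1r ?mul1r ?scale1r.
Qed.

Lemma sgz n : sg n = (-1) ^ n.
Proof.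
case: n => n //=; rewrite /sg /= /exprz /=.
by rewrite -signr_odd; case: odd; rewrite ?invr1 ?invrN1 // invrN1.
Qed.

Lemma sgD m n : sg (m + n) = sg m * sg n.
Proof. by rewrite !sgz expfzDr // oppr_eq0 oner_eq0. Qed.
Lemma sgN n : sg (- n) = sg n.
Proof. by rewrite /sg abszN. Qed.
Lemma sgg n : sg n * sg n = 1.
Proof. by rewrite /sg -expr2 sqrr_sign. Qed.
Lemma sgMn (k : int) (n : nat) : sg (k * n) = sg k ^+ n.
Proof. by rewrite /sg abszM /= exprM. Qed.
Lemma sg0 : sg 0 = 1. Proof. by []. Qed.
Lemma sg1 : sg 1 = -1. Proof. by []. Qed.

Lemma gderE (k : int) (D : O -> O) : graded_derivation k D <->
  [/\ linear D, forall (l : int) x, Omega_ l x -> Omega_ (k + l) (D x) &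
      forall (l : int) x y, Omega_ l x ->
        D (x * y) = D x * y + sg (k * l) *: (x * D y)].
Proof.
by split=> -[h1 h2 h3]; split=> // l x y hx; rewrite (h3 _ _ _ hx) -sgE mulrA.
Qed.

Lemma gder_ext (k : int) (Da : {linear A -> O}) (Dm : {linear O1 -> O}) :
  (forall a, Omega_ k (Da a)) -> (forall m, Omega_ (k + 1) (Dm m)) ->
  (forall a b, Da (a * b) = Da a * scal b + scal a * Da b) ->
  (forall a m, Dm (lact a m) = Da a * form m + scal a * Dm m) ->
  (forall m a, Dm (ract m a) = Dm m * scal a + sg k *: (form m * Da a)) ->
  exists D, [/\ graded_derivation k D, forall a, D (scal a) = Da a &
     forall m, D (form m) = Dm m].
Proof.
move=> ka km DaM Dml Dmr.
have [s [sA sM]] := signaut (@lact K A) (@ract K A) (sg k).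
have [|D [Dl DA DM Dmul]] := @deriv_ext K A O1 (@lact K A) (@ract K A) s Da Dm sA DaM Dml.
  by move=> m a; rewrite Dmr sM scalerAl.
have sO n (x : O) : Omega_nat n x -> s x = sg (k * n) *: x.
  elim: n x => [|n IH] x.
    by move=> [a _ <-]; rewrite mulr0 scale1r; apply: sA.
  elim/On_ind=> [|u v hu hv|w u hu]; first by rewrite raddf0 scaler0.
    by rewrite [s _]raddfD /= hu hv scalerDr.
  rewrite rmorphM /= sM IH // !sgMn exprS -scalerAl -scalerAr scalerA.
  by rewrite mulrC.
have D0 : D 0 = 0 by have := Dl (-1) 0 0; rewrite addr0 !scaleN1r oppr0 addNr.
have DD u v : D (u + v) = D u + D v by have := Dl 1 u v; rewrite !scale1r.
exists D; split=> //; apply/gderE; split=> //.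
  case=> [n|n x /= ->]; last by rewrite D0; apply: Oz0.
  elim: n => [|n IH] x; first by move=> [a _ <-]; rewrite addr0 DA.
  elim/On_ind=> [|u v hu hv|w u hu]; first by rewrite D0; apply: Oz0.
    by rewrite DD; apply: OzD.
  rewrite Dmul DM; apply: OzD.
    have -> : k + n.+1 = (k + 1) + n by rewrite -addrA.
    by apply: OzM.
  rewrite sM -scalerAl; apply: OzZ.
  have -> : k + n.+1 = 1 + (k + n) by rewrite addrCA.
  by apply: OzM; [exact: On1|exact: IH].
case=> [n x y hx|n x y /= ->]; last by rewrite !mul0r D0 scaler0 mul0r addr0.
by rewrite Dmul (sO n) // scalerAl.
Qed.

Lemma gder_uniq (k : int) (D D' : O -> O) :
  graded_derivation k D -> graded_derivation k D' ->
  (forall a, D (scal a) = D' (scal a)) ->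
  (forall a, D (form (d1 a)) = D' (form (d1 a))) -> D = D'.
Proof.
move=> /gderE[Dl _ DM] /gderE[Dl' _ DM'] hA hd.
have lin (E : O -> O) : linear E -> (forall u v, E (u + v) = E u + E v) /\ (forall c u, E (c *: u) = c *: E u).
  move=> El; have E0 : E 0 = 0 by have := El (-1) 0 0; rewrite addr0 !scaleN1r oppr0 addNr.
  split=> [u v|c u]; first by have := El 1 u v; rewrite !scale1r.
  by have := El c u 0; rewrite E0 !addr0.
have [DD DZ] := lin _ Dl; have [DD' DZ'] := lin _ Dl'.
apply/funext=> x; elim/O_ind: x => [a s|u v hu hv|c u hu].
- have oa b : Omega_ 0 (scal b : O) by exists b.
  rewrite (DM 0) // (DM' 0) // hA; congr (_ + _ *: (_ * _)).
  elim: s => [|b s IH]; first by rewrite big_nil -(rmorph1 (@scal K A)) hA.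
  by rewrite big_cons (DM 1) ?(DM' 1) ?hd ?IH //; apply: On1.
- by rewrite DD DD' hu hv.
- by rewrite DZ DZ' hu.
Qed.

Lemma lin_props (E : O -> O) : linear E ->
  [/\ E 0 = 0, forall u v, E (u + v) = E u + E v, forall u v, E (u - v) = E u - E v & forall c u, E (c *: u) = c *: E u].
Proof.
move=> El; have E0 : E 0 = 0 by have := El (-1) 0 0; rewrite addr0 !scaleN1r oppr0 addNr.
have ED u v : E (u + v) = E u + E v by have := El 1 u v; rewrite !scale1r.
have EZ c u : E (c *: u) = c *: E u by have := El c u 0; rewrite E0 !addr0.
by split=> // u v; rewrite ED -scaleN1r EZ scaleN1r.
Qed.

Lemma gcommE k1 k2 D1 D2 (x : O) : gcomm k1 k2 D1 D2 x = D1 (D2 x) - sg (k1 * k2) *: D2 (D1 x).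
Proof. by rewrite /gcomm sgE. Qed.

Lemma gcomm_der k1 k2 (D1 D2 : O -> O) : graded_derivation k1 D1 ->
  graded_derivation k2 D2 -> graded_derivation (k1 + k2) (gcomm k1 k2 D1 D2).
Proof.
move=> /gderE[Dl1 Do1 DM1] /gderE[Dl2 Do2 DM2].
have [D10 D1D D1B D1Z] := lin_props Dl1; have [D20 D2D D2B D2Z] := lin_props Dl2.
apply/gderE; split.
- move=> c u v; rewrite !gcommE !(D1D, D1Z, D2D, D2Z).
  rewrite !scalerDr !scalerN !scalerA [c * _]mulrC opprD -!addrA; congr (_ + _).
  by rewrite addrCA.
- move=> l x hx; rewrite gcommE; apply: OzB; first by rewrite -addrA; apply: Do1; apply: Do2.
  by apply: OzZ; rewrite [k1 + k2]addrC -addrA; apply: Do2; apply: Do1.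
- move=> l x y hx.
  have h12 := Do1 _ _ (Do2 _ _ hx).
  rewrite !gcommE (DM1 l) // (DM2 l) // D1D D2D D1Z D2Z.
  rewrite (DM1 (k2 + l) (D2 x) y (Do2 _ _ hx)) (DM2 (k1 + l) (D1 x) y (Do1 _ _ hx)).
  rewrite (DM1 l x (D2 y) hx) (DM2 l x (D1 y) hx).
  rewrite [k1 * (k2 + l)]mulrDr [k2 * (k1 + l)]mulrDr [(k1 + k2) * l]mulrDl !sgD [k2 * k1]mulrC.
  set e := sg (k1 * k2); set e1 := sg (k1 * l); set e2 := sg (k2 * l).
  have ee : e * e = 1 by apply: sgg.
  rewrite mulrBl mulrBr -scalerAl -scalerAr !scalerDr !scalerA.
  have -> : e1 * e2 * -1 * e = - (e * e1 * e2) by rewrite mulrN1 mulNr mulrC mulrA.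
  rewrite mulrA ee mul1r [e2 * e1]mulrC scaleNr !opprD !addrA.
  by rewrite [LHS](ACl (1*5*4*8*(2*7)*(3*6)))%AC /= !subrr !addr0.
Qed.
End FormsTheory.

(* Existence and uniqueness of the differential, of the insertion operators
   and of the Frolicher-Nijenhuis bracket, each of which is defined above by
   choice: differentialP, is_diff_uniq, insertionP, gder_uniq, FN_bracketP,
   FN_uniq. *)
Section WellDefinedness.
Variables (K : fieldType) (A : algType K).
Notation O := (Omega A).
Notation O1 := (Omega1 A).
Notation T2 := (tens2 A).
Notation dd := (@differential K A).

Lemma hom_ext (F G : {linear A -> O}) :
  exists B : {linear O1 -> O}, forall a b, G 1 = 0 -> B (lact a (d1 b)) = F a * G b.
Proof.
pose f (a b : A) : O := F a * G b.
have fl v : linear (f^~ v) by move=> c x y; rewrite /f linearP mulrDl -scalerAl.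
have fr u : linear (f u) by move=> c x y; rewrite /f linearP mulrDr -scalerAr.
pose B (w : O1) := tlift f (val w).
have Bl : linear B by move=> c x y; rewrite /B linearP tlift_linear.
pose BL : {linear O1 -> O} := HB.pack B (GRing.isLinear.Build K O1 O _ _ Bl).
exists BL => a b G1; rewrite /= /B /= raddfB /= !lmul_pure mulr1.
have := tlift_linear fl fr (-1) (tpure (a * b) 1) (tpure a b).
rewrite !scaleN1r [- _ + _]addrC => ->; rewrite !tlift_pure // /f G1.
by rewrite mulr0 oppr0 add0r.
Qed.

Lemma lact_d1_ract (a b c : A) :
  ract (lact a (d1 b)) c = lact a (d1 (b * c)) - lact (a * b) (d1 c).
Proof.
apply: val_inj; rewrite /= !raddfB /= !lmul_pure !rmul_pure.
by rewrite !mulr1 !mul1r !mulrA opprK addrACA addNr addr0.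
Qed.

Lemma lact_lact (a b : A) (w : O1) : lact a (lact b w) = lact (a * b) w.
Proof.
apply: val_inj => /=; elim/tensor_ind: (form_tens w) => [x y|x y hx hy|c x hx].
- by rewrite !lmul_pure mulrA.
- by rewrite !raddfD /= hx hy.
- by rewrite !linearZ /= hx.
Qed.

Lemma lactD (a b : A) (w : O1) : lact (a + b) w = lact a w + lact b w.
Proof.
apply: val_inj => /=; elim/tensor_ind: (form_tens w) => [x y|x y hx hy|c x hx].
- by rewrite !lmul_pure mulrDl tpureDl.
- by rewrite !raddfD /= hx hy addrACA.
- by rewrite !linearZ /= hx scalerDr.
Qed.

HB.instance Definition _ a := GRing.isLinear.Build K O1 O1 _ (@lact K A a) (@lact_linear K A a).
Lemma ractD a (u v : O1) : ract (u + v) a = ract u a + ract v a.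
Proof. by have := ract_linear a 1 u v; rewrite !scale1r. Qed.
Lemma ractZ a c (u : O1) : ract (c *: u) a = c *: ract u a.
Proof.
have := ract_linear a (-1) 0 0; have := ract_linear a c u 0.
by rewrite !addr0 !scaleN1r oppr0 addNr => -> ->; rewrite addr0.
Qed.

Definition fd1 (a : A) : O := form (d1 a).
HB.instance Definition _ := GRing.Linear.copy fd1 (@form K A \o @d1 K A).

Lemma fd1_M a b : fd1 (a * b) = fd1 a * scal b + scal a * fd1 b.
Proof. by rewrite /fd1 d1M raddfD /= form_ract form_lact. Qed.
Lemma fd1_1 : fd1 1 = 0. Proof. by rewrite /fd1 d1_1 raddf0. Qed.

Lemma diff_exists : exists D : O -> O, [/\ graded_derivation 1 D,
  forall a, D (scal a) = fd1 a & forall a, D (fd1 a) = 0].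
Proof.
have [B HB0] := hom_ext fd1 fd1.
have HB a b : B (lact a (d1 b)) = fd1 a * fd1 b := HB0 a b fd1_1.
have oA a : Omega_nat 0 (scal a : O) by exists a.
have [|||||D [Dg DA Df]] := @gder_ext K A 1 fd1 B.
- by move=> a; apply: On1.
- elim/O1_ind=> [a b|u v hu hv|c u hu].
  + by rewrite HB; apply: (@OnM K A 1 1); apply: On1.
  + by rewrite raddfD; apply: OzD.
  + by rewrite linearZ; apply: OzZ.
- exact: fd1_M.
- move=> a; elim/O1_ind=> [b c|u v hu hv|k u hu].
  + by rewrite lact_lact !HB form_lact -/(fd1 _) fd1_M mulrDl !mulrA.
  + by rewrite !raddfD /= hu hv !mulrDr addrACA.
  + by rewrite !linearZ /= hu -!scalerAr scalerDr.
- move=> w c; elim/O1_ind: w => [a b|u v hu hv|k u hu].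
  + rewrite lact_d1_ract raddfB /= !HB form_lact -!/(fd1 _) !fd1_M sg1 scaleN1r.
    by rewrite mulrDr mulrDl opprD addrA !mulrA addrK.
  + by rewrite ractD !raddfD /= hu hv !mulrDl scalerDr addrACA.
  + rewrite ractZ !linearZ /= hu -!scalerAl scalerDr !scalerA.
    by rewrite [k * _]mulrC.
exists D; split=> // a; rewrite Df.
have -> : d1 a = lact 1 (d1 a).
  by apply: val_inj; rewrite /= raddfB /= !lmul_pure !mul1r.
by rewrite HB fd1_1 mul0r.
Qed.

Lemma diff_is D : graded_derivation 1 D -> (forall a, D (scal a) = fd1 a) ->
  (forall a, D (fd1 a) = 0) -> is_differential D.
Proof.
move=> /gderE[Dl _ DM] DA Df; split=> // a s.
have oa b : Omega_ 0 (scal b : O) by exists b.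
rewrite (DM 0) // DA.
suff -> : D (\prod_(b <- s) form (d1 b)) = 0 by rewrite !mulr0 scaler0 addr0.
elim: s => [|b s IH]; first by rewrite big_nil -(rmorph1 (@scal K A)) DA fd1_1.
have h1 : Omega_ 1 (form (d1 b)) := On1 (d1 b).
by rewrite big_cons (DM 1 _ _ h1) IH -/(fd1 b) Df mul0r mulr0 scaler0 addr0.
Qed.

Lemma is_diff_uniq (D D' : O -> O) : is_differential D -> is_differential D' -> D = D'.
Proof.
move=> [l h] [l' h']; have [_ a _ b] := lin_props l; have [_ a' _ b'] := lin_props l'.
apply/funext=> x; elim/O_ind: x => [c s|u v hu hv|c u hu].
- by rewrite h h'.
- by rewrite a a' hu hv.
- by rewrite b b' hu.
Qed.

Lemma differentialP : [/\ is_differential dd, graded_derivation 1 dd,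
  forall a, dd (scal a) = fd1 a & forall a, dd (fd1 a) = 0].
Proof.
have [D [Dg DA Df]] := diff_exists; have Di := diff_is Dg DA Df.
have Ed : is_differential dd by apply: (@xgetPex _ (fun=> 0) (@is_differential K A)); exists D.
by rewrite (is_diff_uniq Ed Di).
Qed.

Lemma dd2 x : dd (dd x) = 0.
Proof.
have [[dl di] /gderE[_ dO dM] dA df] := differentialP.
have [d0 dD dB dZ] := lin_props dl.
elim/O_ind: x => [a s|u v hu hv|c u hu].
- rewrite di -[form _ * _]mul1r -(rmorph1 (@scal K A)).
  have := di 1 (a :: s); rewrite big_cons => ->.
  by rewrite -/(fd1 1) fd1_1 mul0r.
- by rewrite !dD hu hv addr0.
- by rewrite !dZ hu scaler0.
Qed.

Lemma insertionP k (L : O1 -> O) : Omega1_hom k L -> is_insertion k L (insertion k L).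
Proof.
move=> [Ll Lo La Lr]; apply: (@xgetPex _ (fun=> 0) (is_insertion k L)).
pose LL : {linear O1 -> O} := HB.pack L (GRing.isLinear.Build K O1 O _ _ Ll).
have [|||||D [Dg DA Df]] := @gder_ext K A (k%:Z - 1) \0 LL.
- by move=> a; apply: Oz0.
- by move=> m; rewrite subrK; apply: Lo.
- by move=> a b /=; rewrite mul0r mulr0 addr0.
- by move=> a w /=; rewrite La mul0r add0r.
- by move=> w a /=; rewrite Lr mulr0 scaler0 addr0.
by exists D.
Qed.

Lemma form_span (k : int) (D : O -> O) : graded_derivation k D ->
  forall a b, D (form (lact a (d1 b))) = D (scal a) * fd1 b + scal a * D (fd1 b).
Proof.
move=> /gderE[_ _ DM] a b; rewrite form_lact (DM 0) ?mulr0 ?scale1r //.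
by exists a.
Qed.

Lemma Lie_der k (L : O1 -> O) : Omega1_hom k L -> graded_derivation k%:Z (Lie k L).
Proof.
move=> hL; have [dj _ _] := insertionP hL; have [_ dg _ _] := differentialP.
by rewrite -[k%:Z](subrK 1); apply: gcomm_der.
Qed.

Lemma Lie_scal k (L : O1 -> O) a : Omega1_hom k L -> Lie k L (scal a) = L (d1 a).
Proof.
move=> hL; have [dj jA jf] := insertionP hL; have [_ dg dA df] := differentialP.
have [[dl _] _ _ _] := differentialP; have [d0 _ _ _] := lin_props dl.
by rewrite /Lie gcommE dA jf jA d0 scaler0 subr0.
Qed.

Lemma Lie_comm k (L : O1 -> O) : Omega1_hom k L ->
  forall x, Lie k L (dd x) = sg K k%:Z *: dd (Lie k L x).
Proof.
move=> hL x; have [/gderE[jl _ _] _ _] := insertionP hL.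
have [[dl _] _ _ _] := differentialP; have [d0 dD dB dZ] := lin_props dl.
have [j0 _ _ _] := lin_props jl.
rewrite /Lie !gcommE dd2 j0 sub0r dB dZ dd2 scaler0 subr0 mulr1 sgD sgN sg1.
by rewrite mulrN1 scaleNr opprK.
Qed.

Lemma FN_of_der (k : nat) (D : O -> O) : graded_derivation k%:Z D ->
  (forall x, D (dd x) = sg K k%:Z *: dd (D x)) ->
  exists B, Omega1_hom k B /\ D = Lie k B.
Proof.
move=> Dg Dc; have /gderE[Dl DO DM] := Dg; have [D0 DD DB DZ] := lin_props Dl.
have oA a : Omega_ 0 (scal a : O) by exists a.
pose F a := D (scal a).
have Fl : linear F by move=> c x y; rewrite /F linearP DD DZ.
pose FL : {linear A -> O} := HB.pack F (GRing.isLinear.Build K A O _ _ Fl).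
have FM a b : F (a * b) = F a * scal b + scal a * F b.
  by rewrite /F rmorphM /= (DM 0) // mulr0 scale1r.
have F1 : F 1 = 0.
  by have := FM 1 1; rewrite mulr1 rmorph1 mulr1 mul1r => /eqP; rewrite -subr_eq subrr => /eqP <-.
have [B HB0] := hom_ext (@scal K A) FL.
have HB a b : B (lact a (d1 b)) = scal a * F b by rewrite HB0.
have hB : Omega1_hom k B.
  split.
  - by move=> c u v; rewrite linearP.
  - elim/O1_ind=> [a b|u v hu hv|c u hu].
    + rewrite HB -[k%:Z]add0r; apply: OzM => //.
      by rewrite -[k%:Z]addr0; apply: DO.
    + by rewrite raddfD; apply: OzD.
    + by rewrite linearZ; apply: OzZ.
  - move=> a; elim/O1_ind=> [b c|u v hu hv|c u hu].
    + by rewrite lact_lact !HB rmorphM mulrA.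
    + by rewrite !raddfD /= hu hv mulrDr.
    + by rewrite !linearZ /= hu scalerAr.
  - move=> c; elim/O1_ind=> [a b|u v hu hv|k' u hu].
    + rewrite lact_d1_ract raddfB /= !HB FM rmorphM mulrDr !mulrA addrK.
      by [].
    + by rewrite ractD !raddfD /= hu hv mulrDl.
    + by rewrite ractZ !linearZ /= hu scalerAl.
have B1 a : B (d1 a) = F a.
  have -> : d1 a = lact 1 (d1 a).
    by apply: val_inj; rewrite /= raddfB /= !lmul_pure !mul1r.
  by rewrite HB rmorph1 mul1r.
have [_ _ dA df] := differentialP.
exists B; split=> //; apply: (gder_uniq Dg (Lie_der hB)) => a.
  by rewrite Lie_scal // B1.
by rewrite -/(fd1 a) -dA Dc Lie_comm // Lie_scal // B1.
Qed.

Lemma gcomm_comm k l (D1 D2 : O -> O) : linear D1 -> linear D2 ->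
  (forall x, D1 (dd x) = sg K k *: dd (D1 x)) ->
  (forall x, D2 (dd x) = sg K l *: dd (D2 x)) ->
  forall x, gcomm k l D1 D2 (dd x) = sg K (k + l) *: dd (gcomm k l D1 D2 x).
Proof.
move=> l1 l2 h1 h2 x; have [_ D1D _ D1Z] := lin_props l1; have [_ D2D _ D2Z] := lin_props l2.
have [[dl _] _ _ _] := differentialP; have [d0 dD dB dZ] := lin_props dl.
rewrite !gcommE h1 h2 D1Z D2Z h1 h2 dB dZ scalerBr !scalerA sgD.
by congr (_ *: _ - _ *: _); ring.
Qed.

Lemma FN_bracketP k l (L1 L2 : O1 -> O) : Omega1_hom k L1 -> Omega1_hom l L2 ->
  is_FN_bracket k l L1 L2 (FN_bracket k l L1 L2).
Proof.
move=> h1 h2; apply: (@xgetPex _ (fun=> 0) (is_FN_bracket k l L1 L2)).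
have g1 := Lie_der h1; have g2 := Lie_der h2.
have [l1 _ _] := g1; have [l2 _ _] := g2.
have [||B [hB EB]] := @FN_of_der (k + l) (gcomm k l (Lie k L1) (Lie l L2)).
- exact: gcomm_der.
- by apply: gcomm_comm => //; apply: Lie_comm.
by exists B.
Qed.

Lemma hom_eq k (B B' : O1 -> O) : Omega1_hom k B -> Omega1_hom k B' ->
  (forall a, B (d1 a) = B' (d1 a)) -> B = B'.
Proof.
move=> [l _ a _] [l' _ a' _] h; apply/funext; elim/O1_ind=> [x y|u v hu hv|c u hu].
- by rewrite a a' h.
- by have := l 1 u v; have := l' 1 u v; rewrite !scale1r hu hv => -> ->.
- have := l c u 0; have := l (-1) 0 0; have := l' c u 0; have := l' (-1) 0 0.
  rewrite !addr0 !scaleN1r oppr0 !addNr => -> -> ->; rewrite !addr0 => ->.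
  by rewrite hu.
Qed.

Lemma FN_uniq k l (L1 L2 B : O1 -> O) : Omega1_hom k L1 -> Omega1_hom l L2 ->
  is_FN_bracket k l L1 L2 B -> B = FN_bracket k l L1 L2.
Proof.
move=> h1 h2 [hB EB]; have [hF EF] := FN_bracketP h1 h2.
apply: (hom_eq hB hF) => a.
by rewrite -(Lie_scal _ hB) -(Lie_scal _ hF) -EB -EF.
Qed.

Lemma FN_d1 k l (L1 L2 : O1 -> O) a : Omega1_hom k L1 -> Omega1_hom l L2 ->
  FN_bracket k l L1 L2 (d1 a) = gcomm k l (Lie k L1) (Lie l L2) (scal a).
Proof. by move=> h1 h2; have [hF EF] := FN_bracketP h1 h2; rewrite EF Lie_scal. Qed.
End WellDefinedness.

(* Main.v *)
From HB Require Import structures.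
From mathcomp Require Import all_boot all_algebra.
From mathcomp Require Import boolp classical_sets.
Require Import Defs.
Import GRing.Theory.
Local Open Scope ring_scope.

(* Write Q = 1 - P and let pi_P, pi_Q be the algebra endomorphisms of Omega
   induced by P and Q. On Omega_2 one has j_P = 1 + pi_P - pi_Q, whence
   [P,P] = -2 (pi_P d Q + pi_Q d P), so R = -2 pi_Q d P and Rbar = -2 pi_P d Q.
   Since pi_Q kills exactly the part of Omega_2 lying in the ideal of P(Omega_1),
   R is the obstruction to the involutivity of P(Omega_1), and symmetrically
   Rbar is the obstruction for ker P = Q(Omega_1).
   The first Bianchi identity is the graded Jacobi identity for the odd
   derivation D = L_P, for which L_[P,P] = 2 D^2. The second one comes from the
   weight 0 part of d (d (P (da))) = 0, for the grading by eigenvalues of j_P. *)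

(** * Graded derivations and algebra endomorphisms of the tensor algebra *)

Section GradedDerivations.
Set Implicit Arguments.
Unset Strict Implicit.
Context {K : fieldType} {A : algType K}.
Notation O := (Omega A).
Notation O1 := (Omega1 A).

Lemma Omega_scal (a : A) : Omega_ 0 (scal a).
Proof. by exists a. Qed.

(** A trailing scalar is absorbed into the second factor by the right action, so products of two
    one-forms span [Omega_2] additively. *)
Lemma Omega2_ind (Q : O -> Prop) : Q 0 -> (forall x y, Q x -> Q y -> Q (x + y)) ->
  (forall u v : O1, Q (form u * form v)) ->
  forall x, Omega_nat 2 x -> Q x.
Proof.
move=> Q0 QD Qf; apply: On_ind => // u; apply: On_ind.
- by rewrite mulr0.
- by move=> x y hx hy; rewrite mulrDr; apply: QD.
- by move=> v _ [a _ <-]; rewrite -form_ract; apply: Qf.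
Qed.

Lemma gder_lincomb k c (D D' : O -> O) : graded_derivation k D ->
  graded_derivation k D' ->
  graded_derivation k (fun x => c *: D x + D' x).
Proof.
move=> /gderE[Dl DO DM] /gderE[Dl' DO' DM'].
have [_ DD _ DZ] := lin_props Dl; have [_ DD' _ DZ'] := lin_props Dl'.
apply/gderE; split.
- move=> e u v; rewrite DD DZ DD' DZ' !scalerDr !scalerA [c * e]mulrC.
  by rewrite addrACA.
- by move=> l x hx; apply: OzD; [apply: OzZ; apply: DO|apply: DO'].
- move=> l x y hx; rewrite (DM l) // (DM' l) // !scalerDr mulrDl mulrDr scalerDr.
  by rewrite -scalerAl -scalerAr !scalerA [c * sg _ _]mulrC addrACA.
Qed.

Lemma gder_scal_mul k (D : O -> O) a y : graded_derivation k D ->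
  D (scal a * y) = D (scal a) * y + scal a * D y.
Proof.
by move=> /gderE[_ _ DM]; rewrite (DM 0) ?mulr0 ?scale1r //; apply: Omega_scal.
Qed.

Lemma gder_form_mul k (D : O -> O) w y : graded_derivation k D ->
  D (form w * y) = D (form w) * y + sg K k *: (form w * D y).
Proof. by move=> /gderE[_ _ DM]; rewrite (DM 1) ?mulr1 //; apply: On1. Qed.

Lemma scal1 : scal (1 : A) = 1. Proof. exact: rmorph1. Qed.

(** The functorial action of [S] on the tensor algebra over A. It is a relation because [talg_lift]
    only asserts existence. *)
Definition induced (S : O1 -> O1) (h : O -> O) : Prop :=
  [/\ linear h, {morph h : x y / x * y}, forall a, h (scal a) = scal a &
      forall w, h (form w) = form (S w)].

Lemma induced_exists (S : O1 -> O1) : bimodule_endo S ->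
  exists h, induced S h.
Proof.
move=> [Sl Sla Sra].
pose SL : {linear O1 -> O1} := HB.pack S (GRing.isLinear.Build K O1 O1 _ _ Sl).
pose g : {linear O1 -> O} := @form K A \o SL.
have [||h [ha hm]] :=
  @talg_lift K A O1 (@lact K A) (@ract K A) O (@scal K A) g.
- by move=> a m; rewrite /= Sla form_lact.
- by move=> m a; rewrite /= Sra form_ract.
by exists h; split=> //; [exact: linearP|exact: rmorphM].
Qed.

(** The image of [h] is generated as an algebra by A and the forms [S w], and a graded derivation
    that kills these generators kills all their products. This gives [j_P pi_Q = 0], [j_R pi_Q = 0]
    and [j_Rbar pi_P = 0]. *)
Lemma gder_induced_eq0 k (D : O -> O) S h : graded_derivation k D ->
  induced S h -> (forall a, D (scal a) = 0) ->
  (forall w, D (form (S w)) = 0) -> forall x, D (h x) = 0.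
Proof.
move=> Dg [hl hM hs hf] Da Df; have /gderE[Dl _ _] := Dg.
have [D0 DD _ DZ] := lin_props Dl; have [h0 hD _ hZ] := lin_props hl.
elim/O_ind=> [a s|u v hu hv|c u hu].
- rewrite hM hs (gder_scal_mul _ _ Dg) Da mul0r add0r.
  suff -> : D (h (\prod_(b <- s) form (d1 b))) = 0 by rewrite mulr0.
  elim: s => [|b s IH]; first by rewrite big_nil -scal1 hs Da.
  by rewrite big_cons hM hf (gder_form_mul _ _ Dg) Df IH mul0r mulr0 scaler0 addr0.
- by rewrite hD DD hu hv addr0.
- by rewrite hZ DZ hu scaler0.
Qed.

(** * The differential on one-forms and the bimodule maps built from it *)

Notation dd := (@differential K A).

Lemma diff_lin : [/\ dd 0 = 0, forall u v, dd (u + v) = dd u + dd v,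
  forall u v, dd (u - v) = dd u - dd v & forall c u, dd (c *: u) = c *: dd u].
Proof. by have [[dl _] _ _ _] := @differentialP K A; apply: lin_props. Qed.

Lemma diff_scal_form a (w : O1) :
  dd (scal a * form w) = form (d1 a) * form w + scal a * dd (form w).
Proof.
by have [_ dg dA _] := @differentialP K A; rewrite (gder_scal_mul _ _ dg) dA.
Qed.

Lemma diff_form_mul (w : O1) y :
  dd (form w * y) = dd (form w) * y - form w * dd y.
Proof.
have [_ dg _ _] := @differentialP K A.
by rewrite (gder_form_mul _ _ dg) sg1 scaleN1r.
Qed.

Lemma diff_form_d1 (a : A) : dd (form (d1 a)) = 0.
Proof. by have [_ _ _ h] := @differentialP K A; apply: h. Qed.

Lemma diff_form_degree (w : O1) : Omega_nat 2 (dd (form w)).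
Proof.
have [_ /gderE[_ dO _] _ _] := @differentialP K A.
by have := dO 1 _ (On1 w).
Qed.

Lemma induced_degree S h n x : induced S h -> Omega_nat n x -> Omega_nat n (h x).
Proof.
move=> [hl hM hs hf]; have [h0 hD _ _] := lin_props hl.
elim: n x => [|n IH] x; first by move=> [a _ <-]; rewrite hs; exists a.
elim/On_ind=> [|u v hu hv|w u hu]; first by rewrite h0; apply: On0.
  by rewrite hD; apply: OnD.
by rewrite hM hf; apply/OnS/IH.
Qed.

Lemma bimodule_endo_compl (S : O1 -> O1) :
  bimodule_endo S -> bimodule_endo (compl_endo S).
Proof.
move=> [Sl Sa Sr]; rewrite /compl_endo; split.
- by move=> c u v; rewrite Sl scalerBr opprD addrACA.
- by move=> a w; rewrite Sa -raddfB.
- by move=> a w; rewrite Sr -[- ract _ _]scaleN1r -ractZ -ractD scaleN1r.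
Qed.

Lemma linear_morphisms (U V : lmodType K) (f : U -> V) : linear f ->
  [/\ f 0 = 0, {morph f : u v / u + v}, {morph f : u v / u - v} &
      forall c, {morph f : u / c *: u}].
Proof.
move=> fl; pose g : {linear U -> V} := HB.pack f (GRing.isLinear.Build K U V _ _ fl).
by split; [exact: (raddf0 g)|exact: (raddfD g)|exact: (raddfB g)|exact: (linearZ_LR g)].
Qed.

Lemma hom_of_endo_hom (S : O1 -> O1) :
  bimodule_endo S -> Omega1_hom 1 (hom_of_endo S).
Proof.
move=> [Sl Sa Sr]; rewrite /hom_of_endo; split.
- by move=> c u v; rewrite Sl linearP.
- by move=> w; apply: On1.
- by move=> a w; rewrite Sa form_lact.
- by move=> a w; rewrite Sr form_ract.
Qed.

Lemma Omega1_hom_comp k (L : O1 -> O) (S : O1 -> O1) :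
  Omega1_hom k L -> bimodule_endo S -> Omega1_hom k (L \o S).
Proof.
move=> [Ll LO La Lr] [Sl Sa Sr]; split=> /=.
- by move=> c u v /=; rewrite Sl Ll.
- by move=> w; apply: LO.
- by move=> a w; rewrite Sa La.
- by move=> a w; rewrite Sr Lr.
Qed.

(** [d] is not A-linear, but the extra Leibniz term is a product with the factor [T w], and [h]
    sends that factor to [S (T w) = 0]. *)
Lemma induced_diff_hom S h T : induced S h -> bimodule_endo T ->
  (forall w, S (T w) = 0) -> Omega1_hom 2 (fun w => h (dd (form (T w)))).
Proof.
move=> Sh [Tl Ta Tr] ST; have [hl hM hs hf] := Sh.
have [_ hD hB hZ] := lin_props hl; have [_ dD _ dZ] := diff_lin; split.
- by move=> c u v; rewrite Tl linearP dD dZ hD hZ.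
- by move=> w; apply: (induced_degree Sh); apply: diff_form_degree.
- move=> a w; rewrite Ta form_lact diff_scal_form hD !hM hs !hf ST.
  by rewrite raddf0 mulr0 add0r.
- move=> a w; rewrite Tr form_ract diff_form_mul hB !hM hs hf ST.
  by rewrite raddf0 mul0r subr0.
Qed.

(** As [j_P] has degree 0, it sends [u v] to [P u v + u P v] without a sign. This is what remains of
    [u v + P u P v - Q u Q v] after expanding [Q = 1 - P]. *)
Lemma insertion_endo2 (P : O1 -> O1) (hP : bimodule_endo P) piP piQ :
  induced P piP -> induced (compl_endo P) piQ -> forall y, Omega_nat 2 y ->
  insertion 1 (hom_of_endo P) y = y + piP y - piQ y.
Proof.
move=> [Pl PM _ Pf] [Ql QM _ Qf].
have [P0 PD _ _] := lin_props Pl; have [Q0 QD _ _] := lin_props Ql.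
have [jg _ jf] := insertionP (hom_of_endo_hom hP).
have /gderE[jl _ _] := jg; have [j0 jD _ _] := lin_props jl.
apply: Omega2_ind => [|x y hx hy|u v]; first by rewrite j0 P0 Q0 subr0 addr0.
  by rewrite jD PD QD hx hy opprD !addrA [LHS](ACl (1*4*2*5*3*6))%AC.
rewrite (gder_form_mul _ _ jg) !jf PM QM !Pf !Qf /hom_of_endo /compl_endo.
rewrite scale1r !raddfB /= mulrBl !mulrBr.
set a := _ * _; set b := _ * _; set c := _ * _; set e := _ * _.
by rewrite !opprB !addrA [RHS](ACl (3*5*(1*6)*(2*4)))%AC /= !subrr !addr0.
Qed.

Lemma Omega1_hom_lincomb k c (L L' : O1 -> O) : Omega1_hom k L ->
  Omega1_hom k L' -> Omega1_hom k (fun w => c *: (L w + L' w)).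
Proof.
move=> [Ll LO La Lr] [Ll' LO' La' Lr']; split.
- by move=> e u v; rewrite Ll Ll' addrACA -scalerDr [LHS]scalerDr !scalerA [c * e]mulrC.
- by move=> w; apply/OzZ/OzD.
- by move=> a w; rewrite La La' -mulrDr scalerAr.
- by move=> a w; rewrite Lr Lr' -mulrDl scalerAl.
Qed.

Lemma Lie1_form (P : O1 -> O1) (hP : bimodule_endo P) w :
  Lie 1 (hom_of_endo P) (form w) =
  insertion 1 (hom_of_endo P) (dd (form w)) - dd (form (P w)).
Proof.
have [_ _ jf] := insertionP (hom_of_endo_hom hP).
by rewrite /Lie gcommE jf scale1r.
Qed.

(** On [Omega_2] the kernel of [h] is the part lying in the ideal of [range S]: [h] kills the ideal
    because [T S = 0], and [y - h y] lies in it because [S + T = 1]. So the left side says that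
    [d (S w)] always lies in the ideal. *)
Lemma involutive_range S T h : bimodule_endo S -> induced T h ->
  (forall w, T (S w) = 0) -> (forall w, S w + T w = w) ->
  (forall w, h (dd (form (S w))) = 0) <-> involutive (range S).
Proof.
move=> hS Th TS ST; have [Sl Sa Sr] := hS; have [S0 _ _ _] := linear_morphisms Sl.
have [hl hM hs hf] := Th.
have [h0 hD _ _] := lin_props hl; have [d0 dD _ dZ] := diff_lin.
have distrS : distribution (range S).
  split; first by exists 0.
  - by move=> c _ _ [u _ <-] [v _ <-]; exists (c *: u + v); rewrite ?Sl.
  - by move=> a _ [u _ <-]; exists (lact a u); rewrite ?Sa.
  - by move=> a _ [u _ <-]; exists (ract u a); rewrite ?Sr.
pose I := ideal_gen (range S).
have I0 : I 0 by exists [::]; rewrite ?big_nil.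
have ID x y : I x -> I y -> I (x + y).
  move=> [s hs' ->] [t ht ->]; exists (s ++ t); last by rewrite big_cat.
  by move=> q; rewrite mem_cat => /orP[/hs'|/ht].
have Igen x w y : I (x * form (S w) * y).
  exists [:: (x, S w, y)]; last by rewrite big_seq1.
  by move=> q; rewrite inE => /eqP -> /=; exists w.
have Iind (Q : O -> Prop) : Q 0 -> (forall x y, Q x -> Q y -> Q (x + y)) ->
    (forall x w y, Q (x * form (S w) * y)) -> forall x, I x -> Q x.
  move=> Q0 QD Qg _ [s hs' ->]; elim: s hs' => [|q s IH] hs'; first by rewrite big_nil.
  rewrite big_cons; apply: QD; last by apply: IH => p ps; apply: hs'; rewrite inE ps orbT.
  by have [w _ <-] := hs' q (mem_head _ _); apply: Qg.
have IM x y z : I y -> I (x * y * z).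
  move: y; apply: Iind => [|u v hu hv|u w v]; first by rewrite mulr0 mul0r.
    by rewrite mulrDr mulrDl; apply: ID.
  by rewrite !mulrA -mulrA; apply: Igen.
have IMl x y : I y -> I (x * y) by move=> /(IM x _ 1); rewrite mulr1.
have IMr y z : I y -> I (y * z) by move=> /(IM 1 _ z); rewrite mul1r.
have IN x : I x -> I (- x) by move=> /(IMl (-1)); rewrite mulN1r.
have IZ c x : I x -> I (c *: x).
  by move=> /(IMl (c *: 1)); rewrite -scalerAl mul1r.
split=> [hd|[_ inv] w].
  have I2 y : Omega_nat 2 y -> I (y - h y).
    move: y; apply: Omega2_ind => [|x y hx hy|u v]; first by rewrite h0 subrr.
      by rewrite hD opprD addrACA; apply: ID.
    rewrite hM !hf.
    have -> : form u * form v - form (T u) * form (T v) =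
        1 * form (S u) * form v + form (T u) * form (S v) * 1.
      have fST x : form x = form (S x) + form (T x) by rewrite -raddfD ST.
      rewrite mul1r mulr1 [form u]fST [form v]fST mulrDl.
      by rewrite [form (T u) * _]mulrDr addrA addrK.
    exact: ID.
  have IdS w : I (dd (form (S w))).
    by have := I2 _ (diff_form_degree (S w)); rewrite hd subr0.
  split=> //; apply: Iind => [|x y hx hy|x w y]; first by rewrite d0.
    by rewrite dD; apply: ID.
  have [_ dg _ _] := @differentialP K A; have /gderE[_ _ dM] := dg.
  have hy : I (dd (form (S w) * y)).
    rewrite diff_form_mul; apply: ID; first exact: IMr.
    by apply: IN; have := Igen 1 w (dd y); rewrite mul1r.
  (* The Leibniz rule needs the degree of the left factor [x] for its sign, so [x] is reduced to the
     homogeneous elements [a d b_1 ... d b_n], which span. *)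
  rewrite -mulrA; elim/O_ind: x => [a s|u v hu hv|c u hu].
  - have [n] : exists n, Omega_nat n (scal a * \prod_(b <- s) form (d1 b)).
      exists (size s); apply: OnA; elim: s => [|b s IH].
        by rewrite big_nil -scal1; apply: Omega_scal.
      by rewrite big_cons; apply: OnS.
    move: (scal a * _) => x hx; rewrite (dM n) //.
    apply: ID; last by apply: IZ; apply: IMl.
    by rewrite mulrA; apply: Igen.
  - by rewrite mulrDl dD; apply: ID.
  - by rewrite -scalerAl dZ; apply: IZ.
have : I (dd (form (S w))).
  by apply: inv; have := Igen 1 w 1; rewrite mul1r mulr1.
move: (dd _); apply: Iind => [//|x y hx hy|x v y].
  by rewrite hD hx hy addr0.
by rewrite !hM hf TS raddf0 mulr0 mul0r.
Qed.

(** * Explicit formulas for the curvature and cocurvature of a projection *)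

Section Projection.
Context (P : O1 -> O1) (hP : bimodule_endo P) (hPP : forall w, P (P w) = P w).
Context (piP piQ : O -> O).
Context (hp : induced P piP) (hq : induced (compl_endo P) piQ).
Notation Q := (compl_endo P).
Notation p := (hom_of_endo P).
Notation R := (curvature P).
Notation Rbar := (cocurvature P).

Lemma projPQ w : P (Q w) = 0.
Proof.
have [Pl _ _] := hP; have [_ _ PB _] := linear_morphisms Pl.
by rewrite PB hPP subrr.
Qed.

Lemma projQP w : Q (P w) = 0.
Proof. by rewrite /compl_endo hPP subrr. Qed.

(** Both sides are bimodule homomorphisms, so exact forms [d a] suffice. There the commutator of the
    odd [L_P] with itself doubles [L_P (P (d a)) = j_P d P (d a) - d P (d a)], which is
    [pi_P d P (d a) - pi_Q d P (d a)] by [insertion_endo2]. Finally [d (d a) = 0] turns [d P] into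
    [- d Q] in the first term. *)
Lemma selfbracketE w : selfbracket P w =
  (- 2%:R) *: (piP (dd (form (Q w))) + piQ (dd (form (P w)))).
Proof.
have h1 := hom_of_endo_hom hP; have hQ := bimodule_endo_compl hP.
have [hN _] := FN_bracketP h1 h1.
have hR := Omega1_hom_lincomb (- 2%:R) (induced_diff_hom hp hQ projPQ)
  (induced_diff_hom hq hP projQP).
rewrite /selfbracket (hom_eq hN hR) // => a.
have [pl _ _ _] := hp; have [p0 _ pB _] := lin_props pl.
have [_ _ dB _] := diff_lin.
rewrite FN_d1 // gcommE !Lie_scal // sg1 scaleN1r opprK -mulr2n.
rewrite Lie1_form // hPP (insertion_endo2 hP hp hq (diff_form_degree _)).
rewrite [form (Q _)]raddfB /= dB diff_form_d1 sub0r -[- dd _]sub0r pB p0 sub0r.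
rewrite [X in X *+ 2](ACl (1*4*2*3))%AC /= subrr add0r.
by rewrite sub0r scaleNr -scalerN opprD opprK scaler_nat.
Qed.

Lemma curvatureE w : R w = (- 2%:R) *: piQ (dd (form (P w))).
Proof.
have [pl _ _ _] := hp; have [p0 _ _ _] := lin_props pl; have [d0 _ _ _] := diff_lin.
by rewrite /curvature /= selfbracketE projQP hPP raddf0 d0 p0 add0r.
Qed.

Lemma cocurvatureE w : Rbar w = (- 2%:R) *: piP (dd (form (Q w))).
Proof.
have [pl _ _ _] := hq; have [p0 _ _ _] := lin_props pl; have [d0 _ _ _] := diff_lin.
rewrite /cocurvature /= selfbracketE projPQ /compl_endo -/(Q w) projPQ subr0.
by rewrite raddf0 d0 p0 addr0.
Qed.

Lemma curvature_hom : Omega1_hom 2 R.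
Proof.
have h1 := hom_of_endo_hom hP; have [hN _] := FN_bracketP h1 h1.
exact: (Omega1_hom_comp hN hP).
Qed.

Lemma cocurvature_hom : Omega1_hom 2 Rbar.
Proof.
have h1 := hom_of_endo_hom hP; have [hN _] := FN_bracketP h1 h1.
exact: (Omega1_hom_comp hN (bimodule_endo_compl hP)).
Qed.

(** Since [P + Q = 1]. This reduces the first Bianchi identity to [[P, [P, P]] = 0]. *)
Lemma curvature_add_cocurvature : (fun w => R w + Rbar w) = selfbracket P.
Proof.
have h1 := hom_of_endo_hom hP; have [[Nl _ _ _] _] := FN_bracketP h1 h1.
apply/funext=> w; rewrite /curvature /cocurvature /= /compl_endo.
by have := Nl 1 (P w) (w - P w); rewrite !scale1r [P w + _]addrC subrK => <-.
Qed.

End Projection.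

Lemma FN_selfbracket (P : O1 -> O1) (hP : bimodule_endo P) w :
  FN_bracket 1 2 (hom_of_endo P) (selfbracket P) w = 0.
Proof.
have h1 := hom_of_endo_hom hP; have [hN EN] := FN_bracketP h1 h1.
have [hB _] := FN_bracketP h1 hN.
have h0 : @Omega1_hom K A 3 (fun=> 0).
  split=> [c u v|v|a v|a v]; rewrite ?scaler0 ?addr0 ?mulr0 ?mul0r //.
  exact: Oz0.
have /gderE[Dl _ _] := Lie_der h1; have [_ DD _ _] := lin_props Dl.
rewrite /selfbracket (hom_eq hB h0) // => a.
(* The value at [d a] is now [[D, [D, D]] a] with [D = L_P] of degree 1. The inner sign is -1,
   giving [D D + D D]; the outer one is [(-1)^2 = 1], so the cubes of [D] cancel. *)
rewrite FN_d1 // -EN; move: (Lie 1 _) DD => D DD.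
rewrite !gcommE (sgMn _ 1 2) !sg1 !scaleN1r !opprK sqrrN expr1n scale1r.
by rewrite !DD subrr.
Qed.

(** Insertion lowers the degree of [L] by one; indexing [L] by [k.+1] keeps the resulting degree
    [k + l] a natural number. *)
Lemma insertion_hom_hom k l (L M : O1 -> O) : Omega1_hom k.+1 L ->
  Omega1_hom l M -> Omega1_hom (k + l) (insertion_hom k.+1 L M).
Proof.
move=> hL [Ml MO Ma Mr]; have [jg jA _] := insertionP hL.
have /gderE[jl jO jM] := jg; rewrite /insertion_hom; split=> /=.
- by move=> c u v /=; rewrite Ml jl.
- move=> w; have := jO l _ (MO w); rewrite intS.
  by have -> : 1 + k%:Z - 1 + l%:Z = (k + l)%N by rewrite [1 + _]addrC addrK.
- by move=> a w /=; rewrite Ma (gder_scal_mul _ _ jg) jA mul0r add0r.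
- by move=> a w /=; rewrite Mr (jM l) ?jA ?mulr0 ?scaler0 ?addr0.
Qed.

(** * Separation of eigenvectors in characteristic zero *)

Section CharacteristicZero.
Context (charK : [pchar K] =i pred0).

Lemma natr_neq0 n : n.+1%:R != 0 :> K.
Proof. by have /pcharf0P -> := charK. Qed.

(** Applying [f - (n + 1)] to the sum removes the top eigenvector and multiplies [y 0] by
    [- (n + 1)], which is invertible; then induction applies. *)
Lemma eigen_sum_eq0 (V : lmodType K) (f : {linear V -> V}) n (y : nat -> V) :
  (forall i, f (y i) = i%:R *: y i) -> \sum_(i < n.+1) y i = 0 -> y 0%N = 0.
Proof.
elim: n y => [|n IH] y fy; first by rewrite big_ord1.
move=> sy; pose z i := (i%:R - n.+1%:R) *: y i : V.
have fz i : f (z i) = i%:R *: z i by rewrite /z linearZ /= fy !scalerA mulrC.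
have sz : \sum_(i < n.+1) z i = 0.
  have : f (\sum_(i < n.+2) y i) - n.+1%:R *: \sum_(i < n.+2) y i = 0.
    by rewrite sy raddf0 scaler0 subrr.
  rewrite raddf_sum scaler_sumr -sumrB big_ord_recr /= fy subrr addr0 => h.
  by rewrite -[RHS]h; apply: eq_bigr => i _; rewrite /z fy scalerBl.
have /eqP := IH z fz sz.
by rewrite /z sub0r scaler_eq0 oppr_eq0 (negPf (natr_neq0 n)) => /eqP.
Qed.

Lemma half_double (V : lmodType K) (x : V) : (2%:R^-1 : K) *: (x + x) = x.
Proof. by rewrite -mulr2n -scaler_nat scalerA mulVf ?scale1r ?natr_neq0. Qed.

(** * The second Bianchi identity through the weights of [j_P] *)

Section Bianchi.
Context (P : O1 -> O1) (hP : bimodule_endo P) (hPP : forall w, P (P w) = P w).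
Notation p := (hom_of_endo P).
Notation R := (curvature P).
Notation Rbar := (cocurvature P).
Notation j := (insertion 1 p).
Notation r := (insertion 2 R).
Notation s := (insertion 2 Rbar).
Notation h := (2%:R^-1 : K).

Let hR := curvature_hom hP.
Let hRb := cocurvature_hom hP.

(* The number of factors in P(Omega_1) grades Omega, j_P being the degree. The
   components of d of weights -1 and 2 are - j_R / 2 and - j_Rbar / 2; E is the
   sum of the two others, F the component of weight 1 and G that of weight 0. *)
Let E x := h *: r x + (h *: s x + dd x).
Let F x := j (E x) - E (j x).
Let G x := E x - F x.

Let jg : graded_derivation 0 j.
Proof. by have [] := insertionP (hom_of_endo_hom hP). Qed.
Let ja (a : A) : j (scal a) = 0.
Proof. by have [_ -> _] := insertionP (hom_of_endo_hom hP). Qed.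
Let jf w : j (form w) = form (P w).
Proof. by have [_ _ ->] := insertionP (hom_of_endo_hom hP). Qed.
Let rg : graded_derivation 1 r. Proof. by have [] := insertionP hR. Qed.
Let ra (a : A) : r (scal a) = 0. Proof. by have [_ -> _] := insertionP hR. Qed.
Let rf w : r (form w) = R w. Proof. by have [_ _ ->] := insertionP hR. Qed.
Let sgd : graded_derivation 1 s. Proof. by have [] := insertionP hRb. Qed.
Let sa (a : A) : s (scal a) = 0. Proof. by have [_ -> _] := insertionP hRb. Qed.
Let sf w : s (form w) = Rbar w. Proof. by have [_ _ ->] := insertionP hRb. Qed.

Let gder_linear k (D : O -> O) : graded_derivation k D -> linear D.
Proof. by case. Qed.

Let Eg : graded_derivation 1 E.
Proof.
have [_ dg _ _] := @differentialP K A.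
exact: (gder_lincomb h rg (gder_lincomb h sgd dg)).
Qed.

Let Fg : graded_derivation 1 F.
Proof.
have -> : F = gcomm 0 1 j E by apply/funext=> x; rewrite gcommE scale1r.
exact: (gcomm_der jg Eg).
Qed.

Let RP w : R (P w) = R w.
Proof. by rewrite /curvature /= hPP. Qed.

Let RbP w : Rbar (P w) = 0.
Proof.
have [[Nl _ _ _] _] := FN_bracketP (hom_of_endo_hom hP) (hom_of_endo_hom hP).
rewrite /cocurvature /= projQP // /selfbracket.
by have [-> _ _ _] := linear_morphisms Nl.
Qed.

(** By [curvatureE] the values of [R] lie in the image of [pi_Q], which is generated by A and by
    forms that [P] kills. *)
Let jR w : j (R w) = 0.
Proof.
have [piP hp] := induced_exists hP.
have [piQ hq] := induced_exists (bimodule_endo_compl hP).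
have [_ _ _ jZ] := lin_props (gder_linear jg).
rewrite (curvatureE hP hPP hp hq) jZ (gder_induced_eq0 jg hq) ?scaler0 // => v.
by rewrite jf projPQ // raddf0.
Qed.

Let rR w : r (R w) = 0.
Proof.
have [piP hp] := induced_exists hP.
have [piQ hq] := induced_exists (bimodule_endo_compl hP).
have [_ _ _ rZ] := lin_props (gder_linear rg).
rewrite (curvatureE hP hPP hp hq) rZ (gder_induced_eq0 rg hq) ?scaler0 // => v.
have [Rl _ _ _] := hR; have [R0 _ _ _] := linear_morphisms Rl.
by rewrite rf -RP projPQ.
Qed.

Let sRb w : s (Rbar w) = 0.
Proof.
have [piP hp] := induced_exists hP.
have [piQ hq] := induced_exists (bimodule_endo_compl hP).
have [_ _ _ sZ] := lin_props (gder_linear sgd).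
rewrite (cocurvatureE hP hPP hp hq) sZ (gder_induced_eq0 sgd hp) ?scaler0 // => v.
by rewrite sf RbP.
Qed.

Let jpiP piP y : induced P piP -> Omega_nat 2 y -> j (piP y) = piP y + piP y.
Proof.
move=> [pl pM ps pf]; move: y.
have [p0 pD _ _] := lin_props pl; have [j0 jD _ _] := lin_props (gder_linear jg).
apply: Omega2_ind => [|x y hx hy|u v]; first by rewrite p0 j0 addr0.
  by rewrite pD jD hx hy addrACA.
by rewrite pM !pf (gder_form_mul _ _ jg) scale1r !jf !hPP.
Qed.

Let jRb w : j (Rbar w) = Rbar w + Rbar w.
Proof.
have [piP hp] := induced_exists hP.
have [piQ hq] := induced_exists (bimodule_endo_compl hP).
have [_ _ _ jZ] := lin_props (gder_linear jg).
rewrite (cocurvatureE hP hPP hp hq) jZ (jpiP hp (diff_form_degree _)).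
by rewrite -scalerDr.
Qed.

(** [R] takes vertical forms, of weight 1, to weight 0 and kills horizontal ones, so [j_R] lowers
    weights by one. As an identity of derivations, [[j_R, j_P] = j_R] is checked on [a] and [d a]
    only. *)
Let comm_rj x : j (r x) = r (j x) - r x.
Proof.
have e : gcomm 1 0 r j = r.
  have [r0 _ _ _] := lin_props (gder_linear rg).
  have [j0 _ _ _] := lin_props (gder_linear jg).
  apply: (gder_uniq (gcomm_der rg jg) rg) => a; rewrite gcommE mulr0 scale1r.
    by rewrite ja ra r0 j0 subrr.
  by rewrite jf !rf jR RP subr0.
have /eqP := congr1 (@^~ x) e; rewrite /= gcommE mulr0 scale1r subr_eq => /eqP ->.
by rewrite addrC addKr.
Qed.

(** [Rbar] kills vertical forms and takes horizontal ones, of weight 0, to weight 2, so [j_Rbar]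
    raises weights by two. *)
Let comm_sj x : j (s x) = s (j x) + (s x + s x).
Proof.
have e : gcomm 0 1 j s = fun x => 1 *: s x + s x.
  have [s0 _ _ _] := lin_props (gder_linear sgd).
  have [j0 _ _ _] := lin_props (gder_linear jg).
  apply: (gder_uniq (gcomm_der jg sgd) (gder_lincomb 1 sgd sgd)) => a.
    by rewrite gcommE ja s0 !sa ja scaler0 subrr addr0.
  by rewrite gcommE jf !sf jRb RbP scaler0 subr0 scale1r.
have /eqP := congr1 (@^~ x) e; rewrite /= gcommE !scale1r subr_eq => /eqP ->.
by rewrite addrC.
Qed.

Let E_scal (a : A) : E (scal a) = form (d1 a).
Proof.
by have [_ _ dA _] := @differentialP K A; rewrite /E ra sa dA scaler0 !add0r.
Qed.

Let E_form w : E (form w) = h *: R w + (h *: Rbar w + dd (form w)).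
Proof. by rewrite /E rf sf. Qed.

(** Here [y] and [z] are the images of [d P (d a)] under [pi_P] and [pi_Q], its parts of weight 2
    and 0. The signs differ because [Rbar] involves [d Q (d a) = - d P (d a)]. *)
Let curv_d1 (a : A) : exists y z, [/\ h *: R (d1 a) = - z, h *: Rbar (d1 a) = y,
  j y = y + y, j z = 0 &
  j (dd (form (P (d1 a)))) = dd (form (P (d1 a))) + y - z].
Proof.
have [piP hp] := induced_exists hP.
have [piQ hq] := induced_exists (bimodule_endo_compl hP).
exists (piP (dd (form (P (d1 a))))), (piQ (dd (form (P (d1 a))))).
have hc : h * - 2%:R = -1 by rewrite mulrN mulVf ?natr_neq0.
split.
- by rewrite (curvatureE hP hPP hp hq) scalerA hc scaleN1r.
- have [pl _ _ _] := hp; have [_ _ _ pZ] := lin_props pl; have [_ _ dB _] := diff_lin.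
  rewrite (cocurvatureE hP hPP hp hq) scalerA hc -pZ.
  by rewrite raddfB /= dB diff_form_d1 scaleN1r opprB subr0.
- exact: (jpiP hp (diff_form_degree _)).
- by apply: (gder_induced_eq0 jg hq) => // v; rewrite jf projPQ // raddf0.
- exact: (insertion_endo2 hP hp hq (diff_form_degree _)).
Qed.

Let F_proj (a : A) : F (form (P (d1 a))) = h *: Rbar (d1 a).
Proof.
have [y [z [Ry -> _ jz jX]]] := curv_d1 a.
have [_ jD _ jZ] := lin_props (gder_linear jg).
rewrite /F jf hPP E_form RP Ry RbP scaler0 add0r jD jX -scaleN1r jZ jz scaler0 add0r.
by rewrite scaleN1r opprD opprK !addrA [LHS](ACl (2*(1*5)*(3*4)))%AC /= addNr subrr !addr0.
Qed.

(** As [F = [j_P, E]], this says that [[j_P, .]] acts idempotently on [E]: once the [j_R] and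
    [j_Rbar] terms are removed from [d], only weights 0 and 1 remain. Both sides are derivations, so
    [a] and [d a] suffice. *)
Let comm_Fj x : j (F x) = F (j x) + F x.
Proof.
have e : gcomm 0 1 j F = F.
  apply: (gder_uniq (gcomm_der jg Fg) Fg) => a; rewrite gcommE scale1r.
    have [F0 _ _ _] := lin_props (gder_linear Fg).
    have [E0 _ _ _] := lin_props (gder_linear Eg).
    by rewrite ja F0 subr0 /F ja E0 subr0 E_scal !jf hPP.
  have [y [z [Ry Rby jy jz jX]]] := curv_d1 a.
  have [_ jD jB jZ] := lin_props (gder_linear jg).
  rewrite jf F_proj Rby {1 2}/F !jf !E_form RP Ry Rby RbP diff_form_d1 scaler0 addr0 add0r.
  have jNz : j (- z) = 0 by rewrite -scaleN1r jZ jz scaler0.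
  have -> : j (- z + y) = y + y by rewrite jD jNz jy add0r.
  rewrite jB !jD jy jNz jX add0r !(opprB, opprD, opprK) !addrA.
  by rewrite [LHS](ACl (1*2*5*6*(3*7)*(4*8)))%AC /= !subrr !addr0.
have /eqP := congr1 (@^~ x) e; rewrite /= gcommE !scale1r subr_eq => /eqP ->.
by rewrite addrC.
Qed.

Let FZ := let: And4 _ _ _ q := lin_props (gder_linear Fg) in q.
Let EZ := let: And4 _ _ _ q := lin_props (gder_linear Eg) in q.
Let rD := let: And4 _ q _ _ := lin_props (gder_linear rg) in q.
Let rZ := let: And4 _ _ _ q := lin_props (gder_linear rg) in q.
Let sZ := let: And4 _ _ _ q := lin_props (gder_linear sgd) in q.
Let jD := let: And4 _ q _ _ := lin_props (gder_linear jg) in q.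
Let jB := let: And4 _ _ q _ := lin_props (gder_linear jg) in q.
Let jZ := let: And4 _ _ _ q := lin_props (gder_linear jg) in q.

Let GZ c x : G (c *: x) = c *: G x.
Proof. by rewrite /G EZ FZ -scalerBr. Qed.

Let diffE x : dd x = F x + G x - h *: r x - h *: s x.
Proof.
rewrite [F x + _]addrC subrK /E addrA.
by rewrite [RHS](ACl (3*(1*4)*(2*5)))%AC /= !subrr !addr0.
Qed.

(** Both [[j_P, E]] and [[j_P, F]] equal [F], and [G = E - F]. *)
Let comm_Gj x : j (G x) = G (j x).
Proof.
have jE : j (E x) = F x + E (j x) by rewrite /F subrK.
rewrite /G jB comm_Fj jE; move: (F x) (E (j x)) (F (j x)) => u v w.
by rewrite opprD !addrA [LHS](ACl ((1*4)*2*3))%AC /= subrr add0r.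
Qed.

Let wt k (z : O) := j z = k%:R *: z.

Let wtD k y z : wt k y -> wt k z -> wt k (y + z).
Proof. by rewrite /wt jD scalerDr => -> ->. Qed.
Let wtZ k c z : wt k z -> wt k (c *: z).
Proof. by rewrite /wt jZ => ->; rewrite !scalerA mulrC. Qed.
Let wtF k z : wt k z -> wt k.+1 (F z).
Proof. by rewrite /wt comm_Fj => ->; rewrite FZ -natr1 scalerDl scale1r. Qed.
Let wtG k z : wt k z -> wt k (G z).
Proof. by rewrite /wt comm_Gj => ->; rewrite GZ. Qed.
Let wtr k z : wt k.+1 z -> wt k (r z).
Proof. by rewrite /wt comm_rj => ->; rewrite rZ -natr1 scalerDl scale1r addrK. Qed.
Let wts k z : wt k z -> wt k.+2 (s z).
Proof.
by rewrite /wt comm_sj => ->; rewrite sZ -!natr1 !scalerDl !scale1r addrA.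
Qed.

(** Up to the factor -1/2 this is the weight 0 component of [d (d u) = 0] for [u = P (d a)], a form
    of weight 1. *)
Let rG_GR (a : A) : r (G (form (P (d1 a)))) + G (R (d1 a)) = 0.
Proof.
clearbody G F E; set u := form _; set Y := R _; pose Z := Rbar (d1 a).
have wu : wt 1 u by rewrite /wt jf hPP scale1r.
have wY : wt 0 Y by rewrite /wt jR scale0r.
have wZ : wt 2 Z by rewrite /wt jRb scaler_nat mulr2n.
have du : dd u = h *: Z + G u + (- h) *: Y.
  by rewrite diffE F_proj rf sf RP RbP scaler0 subr0 scaleNr.
(* The entries are the components of [d (d u)] of weights 0 to 3. Weights -1 and 4 would come from
   [r Y] and [s Z], which vanish by [rR] and [sRb]. *)
pose y := nth 0 [:: (- h) *: (r (G u) + G Y);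
  - (h * h) *: r Z + G (G u) + (- h) *: F Y;
  h *: G Z + F (G u) + (h * h) *: s Y; h *: F Z + (- h) *: s (G u)].
have wy i : j (y i) = i%:R *: y i.
  case: i => [|[|[|[|i]]]]; rewrite /y /= -/(wt _ _).
  - by apply: wtZ; apply: wtD; [apply/wtr/wtG|apply: wtG].
  - apply: wtD; last by apply/wtZ/wtF.
    by apply: wtD; [apply/wtZ/wtr|apply/wtG/wtG].
  - apply: wtD; last by apply/wtZ/wts.
    by apply: wtD; [apply/wtZ/wtG|apply/wtF/wtG].
  - by apply: wtD; apply: wtZ; [apply: wtF|apply/wts/wtG].
  (* Beyond the list the value is the default [0], read as [scal 0] so that [ja] applies. *)
  - by rewrite nth_nil /wt ja scaler0.
pose jl : {linear O -> O} := HB.pack j (GRing.isLinear.Build K O O _ _ (gder_linear jg)).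
have sumy : \sum_(i < 4) y i = dd (dd u).
  have [_ dD _ dZ] := diff_lin.
  rewrite du !dD !dZ !diffE sRb rR !scaler0 !subr0 !big_ord_recl big_ord0 /y /= addr0.
  move: (F Z) (G Z) (r Z) (F (G u)) (G (G u)) (r (G u)) (s (G u)) (F Y) (G Y) (s Y).
  move=> fz gz rz fg gg rg' sg' fy gy sy.
  rewrite !(scalerDr, scalerN, scaleNr, scalerA, opprK) !addrA.
  by rewrite [LHS](ACl (9*6*3*7*4*1*10*5*2*8))%AC.
have /eqP := @eigen_sum_eq0 _ jl 3 y wy (etrans sumy (dd2 u)).
by rewrite /y /= scaler_eq0 oppr_eq0 invr_eq0 (negPf (natr_neq0 1)) => /eqP.
Qed.

Lemma bianchi w : 2%:R *: FN_bracket 2 1 R p w =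
  insertion_hom 2 R Rbar w + insertion_hom 2 Rbar R w.
Proof.
have h1 := hom_of_endo_hom hP; have [hB _] := FN_bracketP hR h1.
(* Twice the bracket is written as a sum of two copies, so that both sides are bimodule
   homomorphisms into [Omega_3] and can be compared on exact forms. *)
have hl := Omega1_hom_lincomb 1 hB hB.
have hr := Omega1_hom_lincomb 1 (insertion_hom_hom hR hRb) (insertion_hom_hom hRb hR).
have e := hom_eq hl hr; have := congr1 (@^~ w) (e _); rewrite /= !scale1r.
rewrite scaler_nat mulr2n; apply=> a {w e hl hr}.
rewrite FN_d1 // gcommE !Lie_scal // mulr1 (sgMn _ 1 2).
rewrite sg1 sqrrN expr1n !scale1r -[RHS]half_double.
suff -> : Lie 2 R (p (d1 a)) - Lie 1 p (R (d1 a)) =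
    h *: (r (Rbar (d1 a)) + s (R (d1 a))) by rewrite -scalerDr.
have -> : Lie 1 p (R (d1 a)) = j (dd (R (d1 a))).
  by have [d0 _ _ _] := diff_lin; rewrite /Lie gcommE jR d0 scaler0 subr0.
have -> : Lie 2 R (p (d1 a)) = r (dd (form (P (d1 a)))) + dd (R (d1 a)).
  by rewrite /Lie gcommE rf RP sg1 scaleN1r opprK.
have := rG_GR a; clearbody G F E; set u := form _; set Y := R _; set Z := Rbar _.
move=> rG.
have wY : wt 0 Y by rewrite /wt jR scale0r.
have -> : dd u = h *: Z + G u - h *: Y.
  by rewrite diffE F_proj rf sf RP RbP scaler0 subr0.
have -> : dd Y = F Y + G Y - h *: s Y by rewrite diffE rR scaler0 subr0.
(* [F Y], [G Y] and [s Y] have weights 1, 0 and 2, whence [j (dd Y) = F Y - s Y]. The [F Y] terms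
   then cancel, [r (G u) + G Y] vanishes by [rG_GR], and one half of [r Z + s Y] is left. *)
rewrite -!scaleNr jD (jD (F Y)) jZ (wtF wY) (wtG wY) (wts wY) !rD !rZ rR.
rewrite scale1r scale0r addr0 scaler0 addr0 scalerA mulNr mulVf ?natr_neq0 // scaleN1r.
have hs : - h *: s Y + s Y = h *: s Y.
  by rewrite scaleNr -{2}[s Y]half_double scalerDr addKr.
rewrite opprD opprK !addrA [LHS](ACl (1*(5*7)*(2*4)*(3*6)))%AC /=.
by rewrite rG hs subrr !addr0 scalerDr.
Qed.

End Bianchi.
End CharacteristicZero.
End GradedDerivations.

Theorem proposition4p3 (K : fieldType) (charK : [pchar K] =i pred0)
  (A : algType K) (P : Omega1 A -> Omega1 A)
  (hP : bimodule_endo P) (hPP : forall w, P (P w) = P w) :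
  let p := hom_of_endo P in
  let R := curvature P in
  let Rbar := cocurvature P in
  [/\ Omega1_hom 2 R /\ Omega1_hom 2 Rbar,
      forall w, FN_bracket 1 2 p (fun v => R v + Rbar v) w = 0,
      forall w, 2%:R *: FN_bracket 2 1 R p w
                = insertion_hom 2 R Rbar w + insertion_hom 2 Rbar R w,
      (forall w, R w = 0) <-> involutive (vertical P) &
      (forall w, Rbar w = 0) <-> involutive (horizontal P)].
Proof.
move=> p R Rbar.
have hQ := bimodule_endo_compl hP.
have [piP hp] := induced_exists hP; have [piQ hq] := induced_exists hQ.
(* The factor -2 in [curvatureE] and [cocurvatureE] is invertible, so [R] and [Rbar] vanish exactly
   when [pi_Q d P] and [pi_P d Q] do. *)
have n2 : - 2%:R != 0 :> K by rewrite oppr_eq0 natr_neq0.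
split.
- by split; [apply: curvature_hom|apply: cocurvature_hom].
- by move=> w; rewrite (curvature_add_cocurvature hP) FN_selfbracket.
- exact: bianchi.
- apply: (iff_trans _ (involutive_range hP hq (projQP hPP) _)).
    split=> H w; last by rewrite /R (curvatureE hP hPP hp hq) H scaler0.
    have /eqP := H w; rewrite /R (curvatureE hP hPP hp hq) scaler_eq0 (negPf n2).
    by move=> /eqP.
  by move=> w; rewrite addrC subrK.
(* The kernel of [P] is the image of the complementary projection, so [involutive_range] applies
   again with the two projections exchanged. *)
- have -> : horizontal P = range (compl_endo P).
    apply/seteqP; split=> [w /= Pw|_ [w _ <-]]; last exact: projPQ.
    by exists w; rewrite // /compl_endo Pw subr0.
  apply: (iff_trans _ (involutive_range hQ hp (projPQ hP hPP) _)).
    split=> H w; last by rewrite /Rbar (cocurvatureE hP hPP hp hq) H scaler0.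
    have /eqP := H w; rewrite /Rbar (cocurvatureE hP hPP hp hq) scaler_eq0 (negPf n2).
    by move=> /eqP.
  by move=> w; rewrite /compl_endo subrK.
Qed.
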